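(* There is a constant $C>0$ such that for every integer $n\ge 2$ there exist a polynomial $p$ of degree $n$ and a polynomial $q$ of degree $n-1$, all of whose coefficients have modulus $1$, such that the harmonic polynomial $H(z)=p(z)+\overline{q(z)}$ has at least $\frac{2}{\pi}n\log n - Cn$ zeros in $\mathbb{C}$.
   Context: A zero of $H$ is a point $z\in\mathbb{C}$ with $H(z)=0$. $\log$ is the natural logarithm. *)

(* Defs.v *)
From mathcomp Require Import all_boot all_algebra.
From mathcomp Require Import all_classical all_reals all_analysis.
From mathcomp Require Export complex.
Export GRing.Theory Num.Theory ComplexField.

Local Open Scope ring_scope.

Definition harmH {R : rcfType} (p q : {poly R[i]}) (z : R[i]) : R[i] :=
  p.[z] + (q.[z])^*.

Definition unimod_poly {R : rcfType} (d : nat) (p : {poly R[i]}) : Prop :=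
  size p = d.+1 /\ forall k : nat, (k <= d)%N -> `|p`_k| = 1.

(* Main.v *)
(** Take p = X^n + Q and q = -Q with Q of degree n-1, so that
    p(z) + conj(q(z)) = z^n + 2i Im Q(z).  On the 2n rays through the roots r
    of r^(2n) = -1 the number z^n is purely imaginary, so the zeros on a ray
    are the positive zeros t of one real polynomial of degree n.  If the
    coefficients of Q are drawn independently and uniformly from {1, i, -1, -i},
    the coefficients of that polynomial are, up to scaling, independent with
    mean 0 and variance 1 (except for the leading one, which is harmless), and
    Kac's heuristic predicts (1/pi) log n zeros per ray, half of them with
    t < 1 and half with t > 1.

    The lower bound is obtained by counting sign changes along a mesh.
    Parametrize t = tanh u: the normalized random polynomials at u and v then
    have correlation sech (u - v).  For two normalized sums at angle pi/N
    (correlation cos (pi/N)), the probability of opposite signs is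
    at least 1/N minus a small error: the joint law is nearly invariant
    under rotations of the plane spanned by the two coefficient vectors, and N
    rotations by pi/N turn X into -X.  Near-invariance is proved by Stein's
    method with sign replaced by tanh (d X).  A step of angle pi/N has length
    pi/N + O(1/N^3) in u, so N such steps advance u by pi + O(1/N^2) and produce
    on average one sign change.  As u ranges up to (log n)/2 - O(1), this gives
    (log n)/(2 pi) - O(1) zeros on either side of t = 1. *)

Require Import Defs.
From mathcomp Require Import all_boot all_order all_algebra.
From mathcomp Require Import all_field.
From mathcomp Require Import all_classical all_reals all_analysis.
From mathcomp Require Import complex polyrcf.
From mathcomp Require Import ring lra zify.
Import Order.TTheory GRing.Theory Num.Theory ComplexField.
Import numFieldNormedType.Exports.
Set Implicit Arguments.
Unset Strict Implicit.
Unset Printing Implicit Defensive.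
Local Open Scope ring_scope.

(** * Uniform averages over a finite product space *)

Section Expectation.
Context {R : realType} {I T : finType}.
Implicit Types (f g : {ffun I -> T} -> R).

Definition expect f : R := (\sum_w f w) / #|{ffun I -> T}|%:R.

Lemma expectD f g : expect (fun w => f w + g w) = expect f + expect g.
Proof. by rewrite /expect big_split mulrDl. Qed.

Lemma expectB f g : expect (fun w => f w - g w) = expect f - expect g.
Proof. by rewrite /expect sumrB mulrBl. Qed.

Lemma expectZ c f : expect (fun w => c * f w) = c * expect f.
Proof. by rewrite /expect -mulr_sumr mulrA. Qed.

Lemma expect_sum (J : Type) (r : seq J) (P : pred J) (F : J -> {ffun I -> T} -> R) :
  expect (fun w => \sum_(j <- r | P j) F j w) = \sum_(j <- r | P j) expect (F j).
Proof. by rewrite /expect exchange_big mulr_suml. Qed.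

Lemma expect_le f g : (forall w, f w <= g w) -> expect f <= expect g.
Proof. by move=> fg; rewrite /expect ler_wpM2r ?invr_ge0// ler_sum. Qed.

Lemma eq_expect f g : f =1 g -> expect f = expect g.
Proof. by move=> fg; rewrite /expect (eq_bigr g). Qed.

Lemma ler_norm_expect f : `|expect f| <= expect (fun w => `|f w|).
Proof.
rewrite /expect normrM normfV normr_nat ler_wpM2r ?invr_ge0//.
exact: ler_norm_sum.
Qed.

Hypothesis T_gt0 : (0 < #|T|)%N.

Let card_neq0 : #|{ffun I -> T}|%:R != 0 :> R.
Proof. by rewrite pnatr_eq0 card_ffun expn_eq0 negb_and -lt0n T_gt0. Qed.

Lemma expect_cst c : expect (fun=> c) = c.
Proof. by rewrite /expect sumr_const cardE -cardT -[X in X / _]mulr_natr mulfK. Qed.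

Lemma expect_le_cst f c : (forall w, f w <= c) -> expect f <= c.
Proof. by move=> fc; rewrite -[leRHS]expect_cst; exact: expect_le. Qed.

Lemma exists_ge_expect f : exists w, expect f <= f w.
Proof.
apply: contrapT => no.
have lt_f w : f w < expect f.
  by rewrite ltNge; apply/negP => le_f; apply: no; exists w.
have /existsP[w0 _] : [exists w : {ffun I -> T}, true].
  apply/existsP; have /card_gt0P[t _] := T_gt0.
  by exists [ffun=> t].
suff: expect f < expect f by rewrite ltxx.
rewrite -[ltRHS]expect_cst /expect ltr_pM2r; last first.
  by rewrite invr_gt0 lt_def card_neq0 ler0n.
apply: ltr_sum => [|w _]; last exact: lt_f.
by apply/hasP; exists w0; rewrite ?mem_index_enum.
Qed.

Definition resample k s (w : {ffun I -> T}) : {ffun I -> T} :=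
  [ffun i => if i == k then s else w i].

Lemma expect_resample k f :
  expect f = expect (fun w => (\sum_s f (resample k s w)) / #|T|%:R).
Proof.
rewrite /expect -mulr_suml; congr (_ / _).
(* Exchanging [s] with the k-th coordinate of [w] is an involution on pairs, so it permutes the
   terms of the double sum. *)
have swapK : involutive (fun ws : {ffun I -> T} * T => (resample k ws.2 ws.1, ws.1 k)).
  case=> w s; congr pair; last by rewrite /= ffunE eqxx.
  by apply/ffunP => i; rewrite !ffunE; case: eqP => // ->.
suff -> : \sum_w \sum_s f (resample k s w) = \sum_w \sum_(s : T) f w.
  under [in RHS]eq_bigr do rewrite sumr_const.
  by rewrite sumrMnl -[X in _ = X / _]mulr_natr mulfK ?pnatr_eq0 -?lt0n.
rewrite !pair_big /= [RHS](reindex_inj (inv_inj swapK)) /=.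
exact: eq_bigr.
Qed.

End Expectation.

(** * Stein's identity for sums of independent bounded variables *)

Section Stein.
Context {R : realType} {I T : finType}.
Variable a : I -> T -> R.
Hypothesis T_gt0 : (0 < #|T|)%N.
Hypothesis a_mean : forall i, \sum_s a i s = 0.
Hypothesis a_var : forall i, \sum_s a i s ^+ 2 = #|T|%:R.
Hypothesis a_le2 : forall i s, `|a i s| <= 2.
Implicit Types (x y : I -> R).

Definition lin x (w : {ffun I -> T}) : R := \sum_i x i * a i (w i).

(** [F1] and [F2] play the partial derivatives of [F]. Only these increment bounds enter Stein's
    method, with a common constant [B]. *)
Definition smooth_pair (B : R) (F F1 F2 : R -> R -> R) :=
  forall u v h k,
  [/\ `|F (u + h) (v + k) - F u v - h * F1 u v - k * F2 u v| <= B * (h ^+ 2 + k ^+ 2),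
      `|F1 (u + h) (v + k) - F1 u v| <= B * (`|h| + `|k|) &
      `|F2 (u + h) (v + k) - F2 u v| <= B * (`|h| + `|k|)].

(** Replacing [g] by [c0 + b * c1] and [g'] by [c1] makes the sum vanish, because [b] has mean 0 and
    second moment 1. The two replacement errors remain. *)
Lemma stein_coordinate (b : T -> R) (B c0 c1 : R) (g g' : T -> R) : 0 <= B ->
  \sum_s b s = 0 -> \sum_s b s ^+ 2 = #|T|%:R -> (forall s, `|b s| <= 2) ->
  (forall s, `|g s - c0 - b s * c1| <= B * b s ^+ 2) ->
  (forall s, `|g' s - c1| <= 2 * B * `|b s|) ->
  `|\sum_s (b s * g s - g' s)| <= 6 * B * #|T|%:R.
Proof.
move=> B0 b0 b2 bM Hg Hg'.
have -> : \sum_s (b s * g s - g' s) =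
    \sum_s (b s * (g s - c0 - b s * c1) - (g' s - c1)).
  apply/eqP; rewrite -subr_eq0 -sumrB.
  rewrite (eq_bigr (fun s => c0 * b s + c1 * (b s ^+ 2) - c1)); last by move=> s _; ring.
  rewrite sumrB big_split/= -!mulr_sumr b0 b2 mulr0 add0r sumr_const.
  by rewrite -[X in _ - X]mulr_natr subrr.
apply: le_trans (ler_norm_sum _ _ _) _.
rewrite -b2 [leRHS]mulr_sumr -[X in X <= _]addr0.
have l1 : \sum_s `|b s| <= \sum_s b s ^+ 2.
  have : 0 <= \sum_s (`|b s| - 1) ^+ 2 by apply: sumr_ge0 => s _; exact: sqr_ge0.
  rewrite (eq_bigr (fun s => (b s ^+ 2 - 2 * `|b s|) + 1)); last first.
    by move=> s _; rewrite -(real_normK (num_real (b s))); ring.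
  rewrite big_split /= sumrB sumr_const -mulr_sumr b2.
  lra.
have : \sum_s `|b s * (g s - c0 - b s * c1) - (g' s - c1)| <=
   \sum_s (2 * B * b s ^+ 2 + 2 * B * `|b s|).
  apply: ler_sum => s _; apply: le_trans (ler_normB _ _) _.
  apply: lerD; last exact: Hg'.
  rewrite normrM -mulrA; apply: ler_pM => //.
rewrite addr0 => /le_trans; apply.
rewrite big_split/= -!mulr_sumr.
have : 2 * B * (\sum_i `|b i|) <= 2 * B * (\sum_i b i ^+ 2).
  by rewrite ler_wpM2l// mulr_ge0.
have : 0 <= B * (\sum_i b i ^+ 2).
  by apply: mulr_ge0 => //; apply: sumr_ge0 => s _; exact: sqr_ge0.
lra.
Qed.

Lemma lin_resample x k s w :
  lin x (resample k s w) = \sum_(i | i != k) x i * a i (w i) + x k * a k s.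
Proof.
rewrite /lin (bigD1 k)//= ffunE eqxx addrC; congr (_ + _).
by apply: eq_bigr => i ik; rewrite ffunE (negPf ik).
Qed.

(* Freezing all coordinates but the k-th reduces the claim to E[b g(b)] = E[g'(b)] + O(g'')
   for a single centered variable b of variance 1. *)
Lemma stein_term B F F1 F2 x y k : 0 <= B -> smooth_pair B F F1 F2 ->
  `|expect (fun w => a k (w k) * F (lin x w) (lin y w))
    - x k * expect (fun w => F1 (lin x w) (lin y w))
    - y k * expect (fun w => F2 (lin x w) (lin y w))|
  <= 6 * B * (x k ^+ 2 + y k ^+ 2).
Proof.
move=> B0 HF; rewrite -!expectZ -!expectB.
set f := (fun w => _); rewrite (expect_resample T_gt0 k).
apply: le_trans (ler_norm_expect _) _; apply: expect_le_cst => // w.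
rewrite normrM normfV normr_nat ler_pdivrMr ?ltr0n//.
set X := \sum_(i | i != k) x i * a i (w i).
set Y := \sum_(i | i != k) y i * a i (w i).
have -> : \sum_s f (resample k s w) = \sum_s (a k s * F (X + x k * a k s) (Y + y k * a k s)
   - (x k * F1 (X + x k * a k s) (Y + y k * a k s) + y k * F2 (X + x k * a k s) (Y + y k * a k s))).
  by apply: eq_bigr => s _; rewrite /f !lin_resample ffunE eqxx opprD addrA.
rewrite [X in _ <= X * _](_ : _ = 6 * (B * (x k ^+ 2 + y k ^+ 2))); last by ring.
(* The Taylor base point omits the k-th terms of both forms, so the k-th variable alone supplies the
   increments. *)
apply: (@stein_coordinate _ _ (F X Y) (x k * F1 X Y + y k * F2 X Y)) => //.
- by rewrite mulr_ge0// addr_ge0// sqr_ge0.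
- move=> s; have [+ _ _] := HF X Y (x k * a k s) (y k * a k s).
  by congr (`|_| <= _); ring.
- move=> s; have [_ H1 H2] := HF X Y (x k * a k s) (y k * a k s).
  rewrite (_ : _ - _ = x k * (F1 (X + x k * a k s) (Y + y k * a k s) - F1 X Y) +
     y k * (F2 (X + x k * a k s) (Y + y k * a k s) - F2 X Y)); last by ring.
  apply: le_trans (ler_normD _ _) _; rewrite !normrM.
  have E1 := ler_wpM2l (normr_ge0 (x k)) H1.
  have E2 := ler_wpM2l (normr_ge0 (y k)) H2.
  apply: le_trans (lerD E1 E2) _.
  rewrite !normrM -(real_normK (num_real (x k))) -(real_normK (num_real (y k))).
  set p := `|x k|; set q := `|y k|; set r := `|a k s|.
  have : 0 <= (p - q) ^+ 2 * (B * r).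
    apply: mulr_ge0; first exact: sqr_ge0.
    by apply: mulr_ge0 => //; exact: normr_ge0.
  lra.
Qed.

(** Summing [stein_term] with weights [v] gives Gaussian integration by parts, the inner products of
    [v] with [x] and [y] being the covariances. The error is cubic in the coefficients, hence small
    when each of them is small. *)
Lemma stein B F F1 F2 (v : I -> R) x y : 0 <= B -> smooth_pair B F F1 F2 ->
  `|expect (fun w => lin v w * F (lin x w) (lin y w))
    - (\sum_i v i * x i) * expect (fun w => F1 (lin x w) (lin y w))
    - (\sum_i v i * y i) * expect (fun w => F2 (lin x w) (lin y w))|
  <= 6 * B * \sum_i `|v i| * (x i ^+ 2 + y i ^+ 2).
Proof.
move=> B0 HF.
under eq_expect => w do rewrite /lin mulr_suml.
rewrite expect_sum !mulr_suml -!sumrB mulr_sumr.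
apply: le_trans (ler_norm_sum _ _ _) _; apply: ler_sum => i _.
under eq_expect => w do rewrite -mulrA.
rewrite expectZ -!mulrA -!mulrBr normrM.
rewrite [leRHS](_ : _ = `|v i| * (6 * B * (x i ^+ 2 + y i ^+ 2))); last by ring.
by apply: ler_wpM2l => //; exact: stein_term.
Qed.

(** Stein's identity for the linear function [F u v = u], whose error constant is 0. *)
Lemma expect_lin2 x : expect (fun w => lin x w ^+ 2) = \sum_i x i ^+ 2.
Proof.
have := @stein 0 (fun u _ => u) (fun _ _ => 1) (fun _ _ => 0) x x x (lexx 0).
rewrite mulr0 mul0r => H; apply/eqP; rewrite -subr_eq0 -normr_le0.
have : smooth_pair 0 (fun u _ : R => u) (fun _ _ => 1) (fun _ _ => 0).
  move=> u v h k; split; rewrite mul0r ?subrr ?normr0//.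
  rewrite (_ : _ - _ = 0) ?normr0//; ring.
move/H; rewrite !expect_cst// mulr0 subr0 mulr1.
by [].
Qed.

Lemma expect_norm_lin x : expect (fun w => `|lin x w|) <= (1 + \sum_i x i ^+ 2) / 2.
Proof.
rewrite -expect_lin2 -[X in X + _](@expect_cst _ I T T_gt0) -expectD mulrC -expectZ.
apply: expect_le => w.
have : 0 <= (`|lin x w| - 1) ^+ 2 by exact: sqr_ge0.
rewrite -[lin x w ^+ 2](real_normK (num_real _)).
lra.
Qed.

End Stein.

Lemma ler_normM (R : realDomainType) (x y a b : R) :
  `|x| <= a -> `|y| <= b -> `|x * y| <= a * b.
Proof. by move=> xa yb; rewrite normrM ler_pM. Qed.

(** * Mean value theorem and derivatives of finite sums *)

Section MeanValue.
Context {R : realType}.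
Implicit Types (f df : R -> R).

Lemma mean_value f df (a b : R) : (forall x : R, is_derive x 1 f (df x)) ->
  exists2 c, `|c - a| <= `|b - a| & f b - f a = df c * (b - a).
Proof.
move=> fdf.
have fc x y : {within `[x, y], continuous f}%classic.
  apply: continuous_subspaceT => z.
  exact/differentiable_continuous/derivable1_diffP/ex_derive.
have [ab|/ltW ba] := leP a b.
  have [c] := MVT_segment ab (fun x _ => fdf x) (fc a b).
  rewrite in_itv/= => /andP[ac cb] E; exists c => //.
  by rewrite !ger0_norm ?subr_ge0// lerB.
have [c] := MVT_segment ba (fun x _ => fdf x) (fc b a).
rewrite in_itv/= => /andP[bc ca] E; exists c; last by lra.
by rewrite !ler0_norm ?subr_le0// lerN2 lerB.
Qed.

Lemma mean_value_le f df (M a b : R) : (forall x : R, is_derive x 1 f (df x)) ->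
  (forall x : R, `|df x| <= M) -> `|f b - f a| <= M * `|b - a|.
Proof.
move=> fdf dfM; have [c _ ->] := mean_value a b fdf.
by rewrite normrM ler_wpM2r.
Qed.

Lemma is_derive_bigsum (J : Type) (r : seq J) (h : J -> R -> R) (dh : J -> R) (x : R) :
  (forall j, is_derive x 1 (h j) (dh j)) ->
  is_derive x 1 (fun y => \sum_(j <- r) h j y) (\sum_(j <- r) dh j).
Proof.
move=> hdh; elim: r => [|j r IH].
  rewrite big_nil (_ : (fun=> _) = cst 0); first exact: is_derive_cst.
  by apply/funext => y; rewrite big_nil.
rewrite big_cons (_ : (fun=> _) = h j + (fun y => \sum_(j <- r) h j y)).
  exact: is_deriveD.
by apply/funext => y; rewrite big_cons.
Qed.

End MeanValue.

(** * The hyperbolic tangent as a smooth substitute for the sign *)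

Section Tanh.
Context {R : realType}.
Implicit Types u v x h : R.

Definition tanh x := (expR x - expR (- x)) / (expR x + expR (- x)).
Definition sech x := 2 / (expR x + expR (- x)).

Let den_gt0 x : 0 < expR x + expR (- x).
Proof. by rewrite addr_gt0 ?expR_gt0. Qed.
Let den_neq0 x : expR x + expR (- x) != 0.
Proof. by rewrite gt_eqF. Qed.

Lemma sech_gt0 x : 0 < sech x. Proof. by rewrite divr_gt0. Qed.

Lemma sech2 x : sech x ^+ 2 = 1 - tanh x ^+ 2.
Proof.
have H : expR x * expR (- x) = 1 by rewrite -expRD subrr expR0.
rewrite /sech /tanh !expr_div_n; apply: (mulIf (expf_neq0 2 (den_neq0 x))).
rewrite mulrBl !divfK ?expf_neq0// mul1r.
move: H; set a := expR x; set b := expR (- x) => H.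
have -> : (a + b) ^+ 2 - (a - b) ^+ 2 = 4 * (a * b) by ring.
by rewrite H; ring.
Qed.

Lemma tanhN x : tanh (- x) = - tanh x.
Proof. by rewrite /tanh opprK -mulNr opprB; congr (_ / _); exact: addrC. Qed.

Lemma tanh0 : tanh 0 = 0. Proof. by rewrite /tanh oppr0 subrr mul0r. Qed.

Lemma tanh_lt1 x : tanh x < 1.
Proof.
rewrite ltr_pdivrMr// mul1r ltrD2l.
by apply: lt_trans (expR_gt0 _); rewrite oppr_lt0 expR_gt0.
Qed.

Lemma tanh_gtN1 x : -1 < tanh x.
Proof. by rewrite -[x]opprK tanhN ltrN2 tanh_lt1. Qed.

Lemma tanh_norm_le1 x : `|tanh x| <= 1.
Proof. by rewrite ler_norml !ltW ?tanh_lt1 ?tanh_gtN1. Qed.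

Lemma tanh_ge0 x : 0 <= x -> 0 <= tanh x.
Proof.
move=> x0; apply: divr_ge0; last exact: ltW.
rewrite subr_ge0 ler_expR.
by rewrite (le_trans _ x0)// oppr_le0.
Qed.

Lemma sgr_mul_tanh x y : 0 <= x * y -> 0 <= tanh x * tanh y.
Proof.
have [x0|x0] := leP 0 x; have [y0|y0] := leP 0 y => xy.
- by rewrite mulr_ge0// tanh_ge0.
- have [->|xn0] := eqVneq x 0; first by rewrite tanh0 mul0r.
  by move: xy; rewrite pmulr_rge0 ?lt_def ?xn0// leNgt y0.
- have [->|yn0] := eqVneq y 0; first by rewrite tanh0 mulr0.
  by move: xy; rewrite pmulr_lge0 ?lt_def ?yn0// leNgt x0.
- rewrite -[x]opprK -[y]opprK !(tanhN (- _)) mulrNN.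
  by rewrite mulr_ge0// tanh_ge0// oppr_ge0 ltW.
Qed.

Global Instance is_derive_tanh x : is_derive x 1 tanh (1 - tanh x ^+ 2).
Proof.
rewrite -sech2 /sech.
apply: is_derive_eq; rewrite /GRing.scale/=.
have H : expR x * expR (- x) = 1 by rewrite -expRD subrr expR0.
apply: (mulIf (expf_neq0 2 (den_neq0 x))); rewrite expr_div_n divfK ?expf_neq0//.
move: (den_neq0 x) H; set a := expR x; set b := expR (- x) => ab H.
rewrite (_ : _ * _ ^+ 2 = 4 * (a * b)); first by rewrite H; ring.
by field.
Qed.

Lemma tanh_lipschitz u h : `|tanh (u + h) - tanh u| <= `|h|.
Proof.
have := @mean_value_le _ tanh (fun x => 1 - tanh x ^+ 2) 1 u (u + h) is_derive_tanh.
rewrite mul1r [u + h - u]addrC addKr; apply => x.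
by rewrite ger0_norm -sech2 ?sqr_ge0// sech2 gerBl sqr_ge0.
Qed.

(** The mean value theorem is applied to [tanh] minus its linear part at [u]. The derivative of that
    difference at [c] is [tanh u ^+ 2 - tanh c ^+ 2], of size at most [2 * |c - u|]. *)
Lemma tanh_taylor u h : `|tanh (u + h) - tanh u - h * (1 - tanh u ^+ 2)| <= 2 * h ^+ 2.
Proof.
pose f s := tanh s - s * (1 - tanh u ^+ 2).
pose df s := tanh u ^+ 2 - tanh s ^+ 2.
have fdf (s : R) : is_derive s 1 f (df s).
  by apply: is_derive_eq; rewrite /df/= /GRing.scale/=; ring.
have [c] := mean_value u (u + h) fdf.
rewrite [u + h - u]addrC addKr => cu E.
rewrite (_ : _ - _ = f (u + h) - f u); last by rewrite /f; ring.
rewrite E normrM -real_normK ?num_real// expr2 mulrA ler_wpM2r//.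
apply: le_trans (_ : 2 * `|c - u| <= _); last by rewrite ler_wpM2l.
rewrite /df subr_sqr normrM mulrC ler_pM//.
  by rewrite (le_trans (ler_normD _ _))// -[2]/(1 + 1) lerD// tanh_norm_le1.
by rewrite distrC; have := tanh_lipschitz u (c - u); rewrite [u + _]addrC subrK.
Qed.

Lemma smooth_pair_tanh :
  smooth_pair 2 (fun u _ => tanh u) (fun u _ => 1 - tanh u ^+ 2) (fun _ _ => 0 : R).
Proof.
move=> u v h k; split; last by rewrite subrr normr0 mulr_ge0// addr_ge0.
  rewrite mulr0 subr0 (le_trans (tanh_taylor _ _))// ler_wpM2l//.
  by rewrite lerDl sqr_ge0.
rewrite (_ : _ - (1 - _) = (tanh u - tanh (u + h)) * (tanh u + tanh (u + h))); last by ring.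
rewrite normrM mulrC ler_pM//.
  by rewrite (le_trans (ler_normD _ _))// -[2]/(1 + 1) lerD// tanh_norm_le1.
by rewrite distrC (le_trans (tanh_lipschitz _ _))// lerDl.
Qed.

(** This function arises when a product of two [tanh] values is differentiated along a rotation. *)
Lemma smooth_pair_dtanh_tanh :
  smooth_pair 8 (fun u v => (1 - tanh u ^+ 2) * tanh v)
    (fun u v => - 2 * tanh u * (1 - tanh u ^+ 2) * tanh v)
    (fun u v => (1 - tanh u ^+ 2) * (1 - tanh v ^+ 2)).
Proof.
move=> u v h k.
have := tanh_taylor u h; have := tanh_taylor v k.
have := tanh_lipschitz u h; have := tanh_lipschitz v k.
have := tanh_norm_le1 (u + h); have := tanh_norm_le1 (v + k).
have := tanh_norm_le1 u; have := tanh_norm_le1 v.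
set A := tanh (u + h); set a := tanh u; set B := tanh (v + k); set b := tanh v.
move=> b1 a1 B1 A1 Bb Aa rB rA.
split.
- pose dA := A - a; pose dB := B - b.
  pose ra := dA - h * (1 - a ^+ 2); pose rb := dB - k * (1 - b ^+ 2).
  (* Exact expansion: each term contains a Taylor remainder or at least two increments, next to
     bounded factors. *)
  rewrite (_ : _ - _ = - 2 * a * b * ra - dA ^+ 2 * b + (1 - a ^+ 2) * rb
     - 2 * a * dA * dB - dA ^+ 2 * dB); last by rewrite /ra /rb /dA /dB; ring.
  have na : `|1 - a ^+ 2| <= 1 by rewrite -sech2 ger0_norm ?sqr_ge0// sech2 gerBl sqr_ge0.
  have two : `|- 2 : R| <= 2 by rewrite normrN ger0_norm.
  have n2 : `|- 2 * a * b * ra| <= 2 * 1 * 1 * (2 * h ^+ 2).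
    exact: ler_normM (ler_normM (ler_normM two a1) b1) rA.
  have dA2 : dA ^+ 2 <= h ^+ 2.
    by rewrite -(real_normK (num_real dA)) -(real_normK (num_real h)) lerXn2r ?nnegrE.
  have n3 : `|dA ^+ 2 * b| <= h ^+ 2 * 1.
    by apply: ler_normM => //; rewrite ger0_norm// sqr_ge0.
  have n4 : `|(1 - a ^+ 2) * rb| <= 1 * (2 * k ^+ 2) by exact: ler_normM.
  have n5 : `|2 * a * dA * dB| <= h ^+ 2 + k ^+ 2.
    have : `|2 * a * dA * dB| <= 2 * 1 * `|h| * `|k|.
      apply: ler_normM => //; apply: ler_normM => //; apply: ler_normM => //.
      by rewrite ger0_norm.
    have : 0 <= (`|h| - `|k|) ^+ 2 by exact: sqr_ge0.
    rewrite -(real_normK (num_real h)) -(real_normK (num_real k)).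
    by lra.
  have n6 : `|dA ^+ 2 * dB| <= h ^+ 2 * 2.
    apply: ler_normM; first by rewrite ger0_norm// sqr_ge0.
    by rewrite (le_trans (ler_normB _ _))// -[2]/(1 + 1) lerD.
  have k2 := sqr_ge0 k.
  apply: le_trans (ler_normB _ _) _.
  have := ler_normB (- 2 * a * b * ra - dA ^+ 2 * b + (1 - a ^+ 2) * rb) (2 * a * dA * dB).
  have := ler_normD (- 2 * a * b * ra - dA ^+ 2 * b) ((1 - a ^+ 2) * rb).
  have := ler_normB (- 2 * a * b * ra) (dA ^+ 2 * b).
  by lra.
- pose dA := A - a; pose dB := B - b.
  rewrite (_ : _ - _ = - 2 * (1 - (A ^+ 2 + A * a + a ^+ 2)) * B * dA
      - 2 * a * (1 - a ^+ 2) * dB); last by rewrite /dA /dB; ring.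
  have /andP[a2 a2'] : - 1 <= a <= 1 by rewrite -ler_norml.
  have /andP[A2 A2'] : - 1 <= A <= 1 by rewrite -ler_norml.
  have n1 : `|1 - (A ^+ 2 + A * a + a ^+ 2)| <= 4 by rewrite ler_norml; nra.
  have n2 : `|a * (1 - a ^+ 2)| <= 4 by rewrite ler_norml; nra.
  apply: le_trans (ler_normB _ _) _; rewrite [leRHS]mulrDr lerD//.
    rewrite [leRHS](_ : _ = 2 * 4 * 1 * `|h|); last by ring.
    apply: ler_normM => //; apply: ler_normM => //; apply: ler_normM => //.
    by rewrite normrN ger0_norm.
  rewrite [leRHS](_ : _ = 2 * 4 * `|k|); last by ring.
  rewrite -(mulrA 2); apply: ler_normM => //; apply: ler_normM => //.
  by rewrite ger0_norm.
- pose dA := A - a; pose dB := B - b.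
  rewrite (_ : _ - _ = - (A + a) * (1 - B ^+ 2) * dA - (1 - a ^+ 2) * (B + b) * dB);
    last by rewrite /dA /dB; ring.
  have na : `|1 - a ^+ 2| <= 1 by rewrite -sech2 ger0_norm ?sqr_ge0// sech2 gerBl sqr_ge0.
  have nB : `|1 - B ^+ 2| <= 1 by rewrite -sech2 ger0_norm ?sqr_ge0// sech2 gerBl sqr_ge0.
  have nAa : `|A + a| <= 8 by have := ler_normD A a; lra.
  have nBb : `|B + b| <= 8 by have := ler_normD B b; lra.
  apply: le_trans (ler_normB _ _) _; rewrite [leRHS]mulrDr lerD//.
    rewrite [leRHS](_ : _ = 8 * 1 * `|h|); last by ring.
    by apply: ler_normM => //; apply: ler_normM => //; rewrite normrN.
  rewrite [leRHS](_ : _ = 1 * 8 * `|k|); last by ring.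
  by apply: ler_normM => //; apply: ler_normM.
Qed.

End Tanh.

(** Each step uses [|p - q| <= 1 - p * q] for p, q in [-1, 1], which follows from
    [1 - p * q - (p - q) = (1 - p) * (1 + q)] and its mirror image. *)
Lemma variation_le (R : realFieldType) (q : nat -> R) n : (forall j, `|q j| <= 1) ->
  `|q 0%N - q n| <= \sum_(j < n) (1 - q j * q j.+1).
Proof.
move=> q1; elim: n => [|n IH]; first by rewrite subrr normr0 big_ord0.
rewrite big_ord_recr /=.
have -> : q 0%N - q n.+1 = (q 0%N - q n) + (q n - q n.+1) by ring.
apply: le_trans (ler_normD _ _) _; rewrite lerD//.
have /andP[a1 a2] : - 1 <= q n <= 1 by rewrite -ler_norml.
have /andP[b1 b2] : - 1 <= q n.+1 <= 1 by rewrite -ler_norml.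
by rewrite ler_norml; apply/andP; split; nra.
Qed.

(** * Near-invariance under rotations, and the half-turn argument *)

Section Rotation.
Context {R : realType} {I T : finType}.
Variable a : I -> T -> R.
Hypothesis T_gt0 : (0 < #|T|)%N.
Hypothesis a_mean : forall i, \sum_s a i s = 0.
Hypothesis a_var : forall i, \sum_s a i s ^+ 2 = #|T|%:R.
Hypothesis a_le2 : forall i s, `|a i s| <= 2.

Lemma lin_comb (c p q : R) (x y : I -> R) w :
  lin a (fun i => c * (p * x i + q * y i)) w = c * (p * lin a x w + q * lin a y w).
Proof.
rewrite /lin mulrDr !mulr_sumr -big_split /=; apply: eq_bigr => i _; ring.
Qed.

Variables (x y : I -> R) (d eta : R).
Hypothesis x_norm : \sum_i x i ^+ 2 = 1.
Hypothesis y_norm : \sum_i y i ^+ 2 = 1.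
Hypothesis xy_orth : \sum_i x i * y i = 0.
Hypothesis x_le : forall i, `|x i| <= eta.
Hypothesis y_le : forall i, `|y i| <= eta.
Hypothesis d_ge0 : 0 <= d.
Hypothesis eta_ge0 : 0 <= eta.

Let rot al i := d * (cos al * x i + sin al * y i).
Let drot al i := d * (- sin al * x i + cos al * y i).

Lemma dot_comb p q p' q' :
  \sum_i d * (p * x i + q * y i) * (d * (p' * x i + q' * y i)) = d ^+ 2 * (p * p' + q * q').
Proof.
transitivity (\sum_i d ^+ 2 * (p * p' * x i ^+ 2 + q * q' * y i ^+ 2
   + (p * q' + q * p') * (x i * y i))); first by apply: eq_bigr => i _; ring.
rewrite -mulr_sumr !big_split -!mulr_sumr x_norm y_norm xy_orth /=; ring.
Qed.

Let rot_norm al : \sum_i rot al i ^+ 2 = d ^+ 2.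
Proof.
under eq_bigr do rewrite expr2.
by rewrite dot_comb -!expr2 cos2Dsin2 mulr1.
Qed.

Let drot_le al i : `|drot al i| <= d * (2 * eta).
Proof.
rewrite normrM (ger0_norm d_ge0) ler_wpM2l//.
rewrite (le_trans (ler_normD _ _))//.
have n1 : `|- sin al * x i| <= 1 * eta by rewrite ler_normM// normrN sin_max.
have n2 : `|cos al * y i| <= 1 * eta by rewrite ler_normM// cos_max.
lra.
Qed.

(** [drot] is the derivative of [rot] in the angle. It is orthogonal to [rot al], which removes the
    [F1] term, and its inner product with [rot be] is [d ^+ 2 * sin (be - al)]. *)
Let stein_drot al be :
  `|expect (fun w => lin a (drot al) w *
       ((1 - tanh (lin a (rot al) w) ^+ 2) * tanh (lin a (rot be) w)))
    - d ^+ 2 * sin (be - al) *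
      expect (fun w => (1 - tanh (lin a (rot al) w) ^+ 2) * (1 - tanh (lin a (rot be) w) ^+ 2))|
  <= 192 * d ^+ 3 * eta.
Proof.
have := stein T_gt0 a_mean a_var a_le2 (drot al) (rot al) (rot be) (ler0n _ 8) smooth_pair_dtanh_tanh.
rewrite [X in X * _](_ : _ = 0); last first.
  by rewrite dot_comb mulNr [cos al * _]mulrC addNr mulr0.
rewrite mul0r subr0 dot_comb.
rewrite (_ : - sin al * _ + _ = sin (be - al)); last by rewrite sinB; ring.
move=> /le_trans; apply.
rewrite (_ : 192 * _ * _ = 6 * 8 * (d * (2 * eta) * (d ^+ 2 + d ^+ 2))); last by ring.
rewrite ler_wpM2l// -{1}(rot_norm al) -(rot_norm be) -big_split mulr_sumr.
by apply: ler_sum => i _; rewrite ler_wpM2r// addr_ge0// sqr_ge0.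
Qed.

Definition corr be al :=
  expect (fun w => tanh (lin a (rot al) w) * tanh (lin a (rot (al + be)) w)).

(* In the derivative with respect to [al] the two Stein main terms are
   [d^2 sin be] and [- d^2 sin be] times the same expectation, and cancel. *)
Lemma corr_stable be al : `|corr be al - corr be 0| <= 384 * d ^+ 3 * eta * `|al|.
Proof.
pose dcorr al := expect (fun w =>
  lin a (drot al) w * ((1 - tanh (lin a (rot al) w) ^+ 2) * tanh (lin a (rot (al + be)) w))
  + lin a (drot (al + be)) w *
    ((1 - tanh (lin a (rot (al + be)) w) ^+ 2) * tanh (lin a (rot al) w))).
rewrite -[X in _ * `|X|]subr0.
apply: (@mean_value_le _ _ dcorr) => s.
  rewrite (_ : corr be = (#|{ffun I -> T}|%:R)^-1 \*: (fun al => \sum_w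
     tanh (lin a (rot al) w) * tanh (lin a (rot (al + be)) w))); last first.
    by apply/funext => u; rewrite /corr /expect mulrC.
  rewrite /dcorr /expect mulrC; apply: is_deriveZ.
  apply: is_derive_bigsum => w.
  rewrite (_ : (fun _ => _) = (fun s => tanh (d * (cos s * lin a x w + sin s * lin a y w)) *
     tanh (d * (cos (s + be) * lin a x w + sin (s + be) * lin a y w)))); last first.
    by apply/funext => u; rewrite !lin_comb.
  rewrite !lin_comb.
  apply: is_derive_eq; rewrite /GRing.scale/=; ring.
rewrite /dcorr expectD.
have := stein_drot s (s + be); rewrite [s + be - s]addrC addKr.
have := stein_drot (s + be) s; rewrite opprD addNKr sinN.
under [X in d ^+ 2 * - sin be * X]eq_expect => w do rewrite mulrC.
set p := expect _; set q := expect _; set r := expect _ => Hq Hp.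
rewrite (_ : r + p = (r - d ^+ 2 * sin be * q) + (p - d ^+ 2 * - sin be * q)); last by ring.
apply: le_trans (ler_normD _ _) _.
rewrite (_ : 384 * _ * _ = 192 * d ^+ 3 * eta + 192 * d ^+ 3 * eta); last by ring.
exact: lerD.
Qed.

(* N rotations by pi/N turn X into -X, so the values of tanh along the way have
   total variation at least 2 |tanh (d X)|. *)
Lemma half_turn_le N (be := pi / N%:R) : (0 < N)%N ->
  expect (fun w => `|tanh (d * lin a x w)|) / N%:R - 768 * d ^+ 3 * eta <=
  (1 - expect (fun w => tanh (d * lin a x w) *
       tanh (d * (cos be * lin a x w + sin be * lin a y w)))) / 2.
Proof.
move=> N0.
have N0' : 0 < N%:R :> R by rewrite ltr0n.
have -> : expect (fun w => tanh (d * lin a x w) *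
       tanh (d * (cos be * lin a x w + sin be * lin a y w))) = corr be 0.
  apply: eq_expect => w; rewrite !lin_comb add0r cos0 sin0.
  by rewrite mul1r mul0r addr0.
have K0 := mulr_ge0 (mulr_ge0 (ler0n R 384) (exprn_ge0 3 d_ge0)) eta_ge0.
have be0 : 0 <= be by rewrite divr_ge0// pi_ge0.
have Nbe : N%:R * be = pi by rewrite /be mulrCA divff ?gt_eqF// mulr1.
have turn w : 2 * `|tanh (d * lin a x w)| <=
    \sum_(j < N) (1 - tanh (lin a (rot (j%:R * be)) w) * tanh (lin a (rot (j%:R * be + be)) w)).
  pose q j := tanh (lin a (rot (j%:R * be)) w).
  have -> : 2 * `|tanh (d * lin a x w)| = `|q 0%N - q N|.
    rewrite /q !lin_comb mul0r cos0 sin0 mul1r mul0r addr0 Nbe.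
    rewrite cospi sinpi mul0r addr0 mulN1r mulrN tanhN opprK -mulr2n.
    by rewrite normrMn mulr_natl.
  apply: le_trans (variation_le N _) _ => [j|]; first exact: tanh_norm_le1.
  by apply: ler_sum => j _; rewrite /q -[j.+1%:R]natr1 mulrDl mul1r.
have {turn} := expect_le turn; rewrite expectZ expect_sum.
under eq_bigr do rewrite expectB expect_cst//.
move=> turn.
have : \sum_(i < N) (1 - corr be (i%:R * be)) <= \sum_(i < N) (1 - corr be 0 + 384 * d ^+ 3 * eta * 4).
  apply: ler_sum => i _; rewrite -addrA lerD2l.
  have := corr_stable be (i%:R * be).
  (* All angles used are at most [pi < 4]; after halving, the error per step is
     [384 * 4 / 2 = 768]. *)
  have i4 : `|i%:R * be| <= 4.
    rewrite ger0_norm; last exact: mulr_ge0.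
    have : i%:R * be <= N%:R * be by rewrite ler_wpM2r// ler_nat ltnW.
    by rewrite Nbe; have := @pihalf_lt2 R; lra.
  have := ler_wpM2l K0 i4.
  by rewrite ler_norml => ? /andP[? ?]; lra.
rewrite sumr_const card_ord -[leRHS]mulr_natl => /(le_trans turn).
rewrite mulrDr.
rewrite [X in _ <= X -> _](_ : _ =
  N%:R * 2 * ((1 - corr be 0) / 2 + 768 * d ^+ 3 * eta)); last by field.
by move=> H; rewrite lerBlDr ler_pdivrMr//; lra.
Qed.

End Rotation.

(** * Probability of opposite signs for two correlated sums *)

Section SignChange.
Context {R : realType} {I T : finType}.
Variable a : I -> T -> R.
Hypothesis T_gt0 : (0 < #|T|)%N.
Hypothesis a_mean : forall i, \sum_s a i s = 0.
Hypothesis a_var : forall i, \sum_s a i s ^+ 2 = #|T|%:R.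
Hypothesis a_le2 : forall i s, `|a i s| <= 2.

(* As tanh' = 1 - tanh^2, Stein's identity E[X tanh (d X)] = d E[tanh' (d X)] bounds
   the probability that X is close to 0 in the form used here. *)
Lemma small_ball (x : I -> R) (d eta : R) : \sum_i x i ^+ 2 = 1 ->
  (forall i, `|x i| <= eta) -> 0 < d ->
  expect (fun w => 1 - tanh (d * lin a x w) ^+ 2) <= 1 / d + 12 * eta * d.
Proof.
move=> x1 xeta d0.
have linZ w : lin a (fun i => d * x i) w = d * lin a x w.
  by rewrite /lin mulr_sumr; apply: eq_bigr => i _; rewrite mulrA.
have := stein T_gt0 a_mean a_var a_le2 x (fun i => d * x i) (fun=> 0) (ler0n _ 2) smooth_pair_tanh.
rewrite (_ : \sum_i x i * (d * x i) = d); last first.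
  rewrite -[RHS]mulr1 -x1 mulr_sumr; apply: eq_bigr => i _; ring.
rewrite big1 ?mul0r ?subr0; last by move=> i _; rewrite mulr0.
under [X in _ - _ * X]eq_expect => w do rewrite linZ.
set e := expect (fun w => 1 - _) => H.
have H1 : 6 * 2 * (\sum_i `|x i| * ((d * x i) ^+ 2 + 0 ^+ 2)) <= 12 * eta * d ^+ 2.
  rewrite -[leRHS]mulr1 -[X in _ <= _ * X]x1 mulr_sumr [leRHS]mulr_sumr.
  apply: ler_sum => i _.
  have := ler_wpM2r (mulr_ge0 (sqr_ge0 d) (sqr_ge0 (x i))) (xeta i).
  by lra.
have H2 := expect_norm_lin T_gt0 a_mean a_var a_le2 x.
have H3 : expect (fun w => lin a x w * tanh (lin a (fun i => d * x i) w)) <=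
    expect (fun w => `|lin a x w|).
  apply: expect_le => w; apply: le_trans (ler_norm _) _.
  by rewrite -[leRHS]mulr1 ler_normM// tanh_norm_le1.
move: (le_trans H H1); rewrite ler_norml => /andP[H4 _].
have : d * e <= 1 + 12 * eta * d ^+ 2 by move: H2; rewrite x1; lra.
rewrite -ler_pdivlMl// => /le_trans; apply.
rewrite le_eqVlt; apply/orP; left; apply/eqP; field.
by rewrite gt_eqF.
Qed.

(** For opposite signs the first term is already at most 1. Otherwise the left side equals
    [- (1 - |q|) * (1 - |q'|) / 2], where q and q' are the two [tanh] values. *)
Lemma indicator_tanh_le (d z z' : R) : 0 < d ->
  (1 - tanh (d * z) * tanh (d * z')) / 2
   - (1 - `|tanh (d * z)|) / 2 - (1 - `|tanh (d * z')|) / 2 <= (z * z' < 0)%R%:R.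
Proof.
move=> d0.
have := tanh_norm_le1 (d * z); have := tanh_norm_le1 (d * z').
have [zz'|zz'] := ltP (z * z') 0.
  set q := tanh _; set q' := tanh _ => q1 q1'.
  have : `|q' * q| <= 1 * 1 by exact: ler_normM.
  by rewrite ler_norml => /andP[? ?]; rewrite mulr1n; lra.
have : 0 <= tanh (d * z) * tanh (d * z').
  apply: sgr_mul_tanh; rewrite mulrACA mulr_ge0// mulr_ge0//; exact: ltW.
set q := tanh _; set q' := tanh _ => /ger0_norm qq q1 q1'.
have : 0 <= (1 - `|q|) * (1 - `|q'|) by rewrite mulr_ge0// subr_ge0.
by rewrite -qq (normrM q q') mulr0n; lra.
Qed.

Lemma tanh_scale_lipschitz (d z u : R) : 0 <= d ->
  `|tanh (d * z) - tanh (d * u)| <= d * `|z - u|.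
Proof.
move=> d0; have := tanh_lipschitz (d * u) (d * z - d * u).
rewrite (_ : d * u + _ = d * z); last by ring.
by rewrite -mulrBr (normrM d) (ger0_norm d0).
Qed.

(** The main term [1 / N] comes from the half turn. The loss [2 / d] comes from values near 0, the
    term in [eta] collects the Stein errors, and the last term pays for [Z], [Z'] being only
    approximations within [tp] of the two sums. *)
Lemma sign_change_prob (x y : I -> R) (d eta tp : R) N (be := pi / N%:R)
    (Z Z' : {ffun I -> T} -> R) :
  \sum_i x i ^+ 2 = 1 -> \sum_i y i ^+ 2 = 1 -> \sum_i x i * y i = 0 ->
  (forall i, `|x i| <= eta) -> (forall i, `|y i| <= eta) ->
  1 <= d -> (0 < N)%N ->
  (forall w, `|Z w - lin a x w| <= tp) ->
  (forall w, `|Z' w - (cos be * lin a x w + sin be * lin a y w)| <= tp) ->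
  1 / N%:R - 2 / d - 800 * d ^+ 3 * eta - 2 * d * tp <=
  expect (fun w => (Z w * Z' w < 0)%R%:R).
Proof.
move=> x1 y1 xy xeta yeta d1 N0 Ztp Z'tp.
have d0 : 0 < d by exact: lt_le_trans d1.
have dge0 := ltW d0.
have N0' : 1 <= N%:R :> R by rewrite ler1n.
pose X w := lin a x w; pose X' w := cos be * lin a x w + sin be * lin a y w.
pose x' i := 1 * (cos be * x i + sin be * y i).
have X'E w : lin a x' w = X' w by rewrite lin_comb mul1r.
have x'1 : \sum_i x' i ^+ 2 = 1.
  under eq_bigr do rewrite expr2.
  by rewrite (dot_comb _ x1 y1 xy) -!expr2 cos2Dsin2 expr1n mulr1.
have x'eta i : `|x' i| <= 2 * eta.
  rewrite /x' mul1r (le_trans (ler_normD _ _))//.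
  have n1 : `|cos be * x i| <= 1 * eta by rewrite ler_normM// cos_max.
  have n2 : `|sin be * y i| <= 1 * eta by rewrite ler_normM// sin_max.
  lra.
have B1 := small_ball x1 xeta d0.
have B2 := small_ball x'1 x'eta d0.
have [I0|/card_gt0P[i0 _]] := posnP #|I|.
  move: x1; rewrite big1 => [/eqP|i _]; first by rewrite eq_sym oner_eq0.
  by have := card0_eq I0 i; rewrite inE.
have eta_ge0 : 0 <= eta by apply: le_trans (xeta i0).
have B3 := half_turn_le T_gt0 a_mean a_var a_le2 x1 y1 xy xeta yeta dge0 eta_ge0 N0.
rewrite -/be in B3.
have sq_norm u : 1 - `|tanh (d * u)| <= 1 - tanh (d * u) ^+ 2.
  have := tanh_norm_le1 (d * u); rewrite -[tanh (d * u) ^+ 2](real_normK (num_real _)).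
  have := normr_ge0 (tanh (d * u)); nra.
(* Passing from [Z], [Z'] to the sums alters each [tanh] by at most [d * tp]. The product accounts
   for one [d * tp] in total, the two absolute values for another. *)
have main w : (1 - tanh (d * X w) * tanh (d * X' w)) / 2
   - (1 - tanh (d * X w) ^+ 2) / 2 - (1 - tanh (d * lin a x' w) ^+ 2) / 2 - 2 * d * tp
   <= (Z w * Z' w < 0)%R%:R.
  apply: le_trans (indicator_tanh_le (Z w) (Z' w) d0).
  rewrite X'E.
  have := sq_norm (X w); have := sq_norm (X' w).
  have := tanh_scale_lipschitz (Z w) (X w) dge0.
  have := tanh_scale_lipschitz (Z' w) (X' w) dge0.
  have := ler_wpM2l dge0 (Ztp w); have := ler_wpM2l dge0 (Z'tp w).
  rewrite -/(X w) -/(X' w).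
  have := tanh_norm_le1 (d * Z w); have := tanh_norm_le1 (d * X' w).
  set p := tanh (d * Z w); set p' := tanh (d * Z' w).
  set q := tanh (d * X w); set q' := tanh (d * X' w) => q'1 p1 e' e f' f.
  have g : `|p - q| <= d * tp by exact: le_trans f e.
  have g' : `|p' - q'| <= d * tp by exact: le_trans f' e'.
  have h1 : `|p * (p' - q')| <= 1 * (d * tp) by exact: ler_normM.
  have h2 : `|(p - q) * q'| <= d * tp * 1 by exact: ler_normM.
  have h3 := lerB_dist q p; have h4 := lerB_dist q' p'.
  rewrite (distrC q) in h3; rewrite (distrC q') in h4.
  move: h1 h2; rewrite !ler_norml => /andP[? ?] /andP[? ?].
  have : p * p' = q * q' + p * (p' - q') + (p - q) * q' by ring.
  by lra.
apply: le_trans (expect_le main).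
have split_expect (f g h : {ffun I -> T} -> R) c :
    expect (fun w => (1 - f w) / 2 - g w / 2 - h w / 2 - c) =
    (1 - expect f) / 2 - expect g / 2 - expect h / 2 - c.
  transitivity (expect (fun w => 2^-1 * (1 - f w) - 2^-1 * g w - 2^-1 * h w - c)).
    by apply: eq_expect => w; ring.
  by rewrite !expectB !expectZ expectB !expect_cst//; ring.
rewrite split_expect.
have B4 : 1 - expect (fun w => 1 - tanh (d * X w) ^+ 2) <=
    expect (fun w => `|tanh (d * X w)|).
  rewrite lerBlDr -lerBlDl -{1}(@expect_cst _ I T T_gt0 1) -expectB.
  by apply: expect_le => w; exact: sq_norm.
move: B1 B2 B3 B4; rewrite -/X -/X'.
set e0 := expect (fun w => `|_|); set e1 := expect (fun w => tanh _ * tanh _).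
set e2 := expect (fun w => 1 - tanh (d * X w) ^+ 2).
set e3 := expect (fun w => 1 - tanh (d * lin a x' w) ^+ 2) => B1 B2 B3 B4.
have ed : eta * d <= d ^+ 3 * eta.
  by rewrite mulrC ler_wpM2r// -[leLHS]expr1 ler_weXn2l.
pose b := 1 / d + 12 * eta * d.
have b0 : 0 <= b.
  by apply: addr_ge0; [exact: divr_ge0|apply: mulr_ge0 => //; exact: mulr_ge0].
have : 1 / N%:R - b <= e0 / N%:R.
  rewrite ler_pdivlMr ?(lt_le_trans ltr01)// mulrBl divfK ?gt_eqF ?(lt_le_trans ltr01)//.
  have := ler_wpM2l b0 N0'; rewrite mulr1 => bN.
  by move: B1; rewrite -/b => B1; lra.
have -> : 2 / d = 2 * (1 / d) by rewrite mulrA mulr1.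
have E0 : 0 <= d ^+ 3 * eta by apply: mulr_ge0 => //; exact: exprn_ge0.
move: B1 B2 B3 B4 ed b0 E0; rewrite /b.
set D := 1 / d; set E := d ^+ 3 * eta; set N1 := 1 / N%:R; set M := e0 / _.
set F := eta * d.
rewrite -!(mulrA _ eta d) -/F -!(mulrA _ (d ^+ 3) eta) -/E.
have -> : 12 * (2 * eta) * d = 24 * F by rewrite /F; ring.
by lra.
Qed.

End SignChange.

(** * The step angle and the corresponding hyperbolic step length *)

Section Angles.
Context {R : realType}.
Implicit Types b u v : R.

Lemma sin_norm_le b : `|sin b| <= `|b|.
Proof.
have := @mean_value_le _ sin cos 1 0 b (@is_derive_sin _) (@cos_max _).
by rewrite sin0 !subr0 mul1r.
Qed.

Lemma cos_lower b : 1 - b ^+ 2 / 2 <= cos b.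
Proof.
rewrite (_ : b = (b / 2) *+ 2); last by rewrite -mulr_natr divfK.
rewrite cos_mulr2n cos2sin2.
have := sin_norm_le (b / 2).
rewrite -ler_sqr ?nnegrE// !real_normK ?num_real//.
set s := sin _; rewrite -mulr_natr; nra.
Qed.

Section Steps.
Variable N : nat.
Hypothesis N_ge5 : (5 <= N)%N.

Let be : R := pi / N%:R.

Let N0 : 0 < N%:R :> R. Proof. by rewrite ltr0n (leq_trans _ N_ge5). Qed.

Lemma step_angle_gt0 : 0 < be. Proof. by rewrite divr_gt0// pi_gt0. Qed.

Lemma step_angle_le : be <= 4 / 5.
Proof.
rewrite ler_pdivrMr//.
have : 5%:R <= N%:R :> R by rewrite ler_nat.
have := @pihalf_lt2 R; lra.
Qed.

Lemma sin_step_angle : 1 / N%:R <= sin be.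
Proof.
have [c] := mean_value 0 be (@is_derive_sin R).
have := step_angle_gt0; have := step_angle_le.
rewrite sin0 !subr0 => b1 b0 cb ->.
rewrite (gtr0_norm b0) in cb.
(* Hence [cos c >= 17 / 25], which together with [pi >= 2] makes [cos c * pi] exceed 1. *)
have c2 : c ^+ 2 <= 16 / 25.
  rewrite -(real_normK (num_real c)).
  have := normr_ge0 c; nra.
have := cos_lower c => cc.
rewrite /be mulrA ler_pM2r ?invr_gt0//.
have := @pi_ge2 R; nra.
Qed.

(* The inverse Gudermannian of pi/N, see [sech_step_length]. *)
Definition step_length : R := ln (1 + sin be) - ln (cos be).

(** The inverse Gudermannian vanishes at 0 and has derivative [1 / cos], which lies between 1 and
    [1 + be ^+ 2] on the interval. *)
Lemma step_length_bounds : be <= step_length <= be + be ^+ 3.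
Proof.
have b0 := step_angle_gt0; have b1 := step_angle_le.
pose f b : R := ln (1 + sin b) - ln (cos b).
have cosP c : c \in `[0, be]%R -> 1 - be ^+ 2 / 2 <= cos c /\ 0 <= sin c.
  rewrite in_itv/= => /andP[c0 c1]; split.
    apply: le_trans (cos_lower c); nra.
  apply: sin_ge0_pi; rewrite c0/=; apply: le_trans c1 _.
  have := @pi_ge2 R; lra.
have fdf c : c \in `[0, be]%R -> is_derive c 1 f ((cos c)^-1).
  move=> /cosP[c1 s0].
  have cc : 0 < cos c by nra.
  have ss : 0 < 1 + sin c by lra.
  have D1 := is_derive1_ln ss; have D2 := is_derive1_ln cc.
  have D3 : is_derive c 1 (fun b => ln (1 + sin b)) ((1 + sin c)^-1 * cos c).
    have D0 : is_derive c 1 (fun b => 1 + sin b) (cos c).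
      by apply: is_derive_eq; rewrite add0r mul1r.
    exact: (@is_derive1_comp R (@ln R) (fun b => 1 + sin b) c _ _ D1 D0).
  have D4 : is_derive c 1 (fun b => ln (cos b)) ((cos c)^-1 * - sin c).
    exact: (@is_derive1_comp R (@ln R) (@cos R) c _ _ D2 (@is_derive_cos R c)).
  have := is_deriveB D3 D4.
  congr (is_derive _ _ _ _).
  have := cos2Dsin2 c; set C := cos c; set S := sin c => CS.
  have -> : (1 + S)^-1 * C - C^-1 * - S = ((C ^+ 2 + S ^+ 2) + S) / ((1 + S) * C).
    by field; rewrite !gt_eqF.
  by rewrite CS; field; rewrite !gt_eqF.
have fc : {within `[0, be], continuous f}%classic.
  by apply: derivable_within_continuous => x /fdf ?; exact: ex_derive.
have fdf' c : c \in `]0, be[%R -> is_derive c 1 f ((cos c)^-1).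
  by move=> cb; apply: fdf; exact: subset_itv_oo_cc cb.
have [c /cosP[c1 _]] := @MVT_segment R f (fun c => (cos c)^-1) 0 be (ltW b0) fdf' fc.
rewrite {2}/f sin0 cos0 addr0 ln1 !subr0 => E.
rewrite /step_length -/(f be) E.
have cc : 0 < cos c by nra.
rewrite [_ * be]mulrC -{1}[be]mulr1 ler_pM2l// invf_ge1// cos_le1/=.
rewrite exprS -{2}[be]mulr1 -mulrDr ler_pM2l// -[leRHS]invrK lef_pV2 ?posrE//; last first.
  by rewrite invr_gt0 ltr_wpDr ?sqr_ge0.
rewrite -div1r ler_pdivrMr ?ltr_wpDr ?sqr_ge0//.
have be2 : be ^+ 2 <= 1 by nra.
have := ler_wpM2r (addr_ge0 (ler01) (sqr_ge0 be)) c1.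
have : 0 <= be ^+ 2 * (1 - be ^+ 2) by rewrite mulr_ge0 ?sqr_ge0 ?subr_ge0.
by set b2 := be ^+ 2; rewrite (mulrC (cos c)); lra.
Qed.

(** This fixes the choice of the step: the correlation of normalized Kac polynomials one step apart
    is exactly that of a rotation by pi/N. *)
Lemma sech_step_length : sech step_length = cos be.
Proof.
have b0 := step_angle_gt0; have b1 := step_angle_le.
have cc : 0 < cos be by have := cos_lower be; nra.
have ss : 0 < 1 + sin be.
  apply: ltr_wpDr ltr01; apply: le_trans sin_step_angle; exact: divr_ge0.
rewrite /sech /step_length opprB !expRD !expRN !lnK ?posrE//.
have := cos2Dsin2 be; move: cc ss; set C := cos _; set S := sin _ => cc ss CS.
have -> : (1 + S) / C + C / (1 + S) = (1 + 2 * S + (C ^+ 2 + S ^+ 2)) / (C * (1 + S)).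
  by field; rewrite !gt_eqF.
rewrite CS (_ : 1 + 2 * S + 1 = 2 * (1 + S)); last by ring.
by field; rewrite !gt_eqF.
Qed.

End Steps.
End Angles.

(** * Identities and decay bounds for [sech] and [tanh] *)

Section Hyperbolic.
Context {R : realType}.
Implicit Types u v : R.

(** The addition formula for cosh, written so that it cancels the denominator of the geometric
    series in the Kac covariance. *)
Lemma sech_mul u v : sech u * sech v = sech (v - u) * (1 - tanh u * tanh v).
Proof.
rewrite /sech /tanh opprB !expRD !expRN.
have := expR_gt0 u; have := expR_gt0 v.
set a := expR u; set b := expR v => b0 a0.
have h1 : 0 < a^-1 + a by rewrite addr_gt0 ?invr_gt0.
have h2 : 0 < a * a + b * b by rewrite addr_gt0 ?mulr_gt0.
have h3 : 0 < a * a + 1 by rewrite addr_gt0 ?mulr_gt0.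
have h4 : 0 < b * b + 1 by rewrite addr_gt0 ?mulr_gt0.
by field; rewrite !gt_eqF //=; lra.
Qed.

Lemma tanh_lt u v : u < v -> tanh u < tanh v.
Proof.
move=> uv; have [c _ E] := mean_value u v (@is_derive_tanh R).
by rewrite -subr_gt0 E -sech2 mulr_gt0 ?subr_gt0// exprn_gt0// sech_gt0.
Qed.

Lemma tanh_le u v : u <= v -> tanh u <= tanh v.
Proof. by rewrite le_eqVlt => /predU1P[->//|/tanh_lt/ltW]. Qed.

Lemma sech_le u v : 0 <= u -> u <= v -> sech v <= sech u.
Proof.
move=> u0 uv; rewrite -ler_sqr ?nnegrE ?(ltW (sech_gt0 _))// !sech2 lerD2l lerN2.
by rewrite ler_sqr ?nnegrE ?tanh_ge0 ?(le_trans u0)// tanh_le.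
Qed.

Lemma sech_le_expR u : sech u <= 2 * expR (- u).
Proof.
rewrite /sech ler_pdivrMr ?addr_gt0 ?expR_gt0// -mulrA mulrDr -expRD addNr expR0.
by rewrite ler_peMr// lerDl mulr_ge0// expR_ge0.
Qed.

(** From [tanh u <= 1 - expR (- (2 * u)) <= expR (- expR (- (2 * u)))]. It controls the truncated
    tail of the series. *)
Lemma tanh_expn_le u n : 0 <= u -> tanh u ^+ n <= expR (- (n%:R * expR (- (2 * u)))).
Proof.
move=> u0; rewrite mulrC -mulNr expRM_natr lerXn2r ?nnegrE ?tanh_ge0 ?expR_ge0//.
apply: le_trans (expR_ge1Dx _).
rewrite (_ : - (2 * u) = - u + - u); last by ring.
rewrite expRD /tanh ler_pdivrMr ?addr_gt0 ?expR_gt0//.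
have : expR u * expR (- u) = 1 by rewrite -expRD subrr expR0.
have : expR (- u) <= 1 by rewrite -expR0 ler_expR oppr_le0.
have := expR_gt0 (- u); have := expR_gt0 u.
set a := expR u; set b := expR (- u) => a0 b0 b1 ab.
have -> : (1 - b * b) * (a + b) = a + b - b * (a * b) - b ^+ 3 by ring.
rewrite ab; nra.
Qed.

End Hyperbolic.

(** * One mesh step for the normalized Kac polynomial *)

Section KacStep.
Context {R : realType} {T : finType}.
Variables (n N : nat) (a : 'I_n.+2 -> T -> R).
Hypothesis T_gt0 : (0 < #|T|)%N.
Hypothesis a_mean : forall i, \sum_s a i s = 0.
Hypothesis a_var : forall i, \sum_s a i s ^+ 2 = #|T|%:R.
Hypothesis a_le2 : forall i s, `|a i s| <= 2.
Hypothesis N_ge5 : (5 <= N)%N.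
Variable u : R.
Hypothesis u_ge0 : 0 <= u.

Let be : R := pi / N%:R.
Let u' := u + step_length N.

(* Coefficients of the normalized Kac polynomial at t = tanh v.  The two coordinates
   n and n+1 do not occur in the polynomial: they replace the tail k >= n of the
   geometric series, so that the Gram matrix is exactly that of the infinite series. *)
Definition kac_vector (v c s : R) (k : nat) : R :=
  if (k < n)%N then sech v * tanh v ^+ k
  else if k == n then tanh v ^+ n * c else tanh v ^+ n * s.

Lemma sum_kac_vector v c s (f : nat -> R) :
  \sum_(k < n.+2) kac_vector v c s k * f k =
  sech v * (\sum_(k < n) f k * tanh v ^+ k) + tanh v ^+ n * c * f n + tanh v ^+ n * s * f n.+1.
Proof.
rewrite !big_ord_recr /= /kac_vector ltnn eqxx ltnNge leqnSn/= gtn_eqF//.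
rewrite mulr_sumr; congr (_ + _ + _).
by apply: eq_bigr => i _; rewrite ltn_ord; ring.
Qed.

(** The finite geometric sum falls short of [sech (v' - v)] by the factor
    [1 - tanh v ^+ n * tanh v' ^+ n]. The two tail coordinates contribute exactly what is
    missing. *)
Lemma kac_vector_dot v c s v' c' s' : sech (v' - v) = c * c' + s * s' ->
  \sum_(k < n.+2) kac_vector v c s k * kac_vector v' c' s' k = sech (v' - v).
Proof.
move=> E; rewrite sum_kac_vector.
rewrite (eq_bigr (fun i : 'I_n => sech v' * (tanh v * tanh v') ^+ i)); last first.
  by move=> i _; rewrite /kac_vector ltn_ord (exprMn _ (tanh v)); ring.
rewrite -mulr_sumr mulrA sech_mul /kac_vector ltnn eqxx ltnNge leqnSn/= gtn_eqF//.
have := subrX1 (tanh v * tanh v') n; rewrite (exprMn _ (tanh v)) => geo.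
have : (1 - tanh v * tanh v') * \sum_(i < n) (tanh v * tanh v') ^+ i =
   1 - tanh v ^+ n * tanh v' ^+ n by rewrite -opprB mulNr -geo opprB.
rewrite -mulrA => ->; rewrite E; ring.
Qed.

Lemma step_length_ge0 : 0 <= step_length N :> R.
Proof.
have /andP[+ _] := @step_length_bounds R N N_ge5.
by apply: le_trans; exact/ltW/step_angle_gt0.
Qed.

Let u'_ge0 : 0 <= u'. Proof. by rewrite addr_ge0// step_length_ge0. Qed.
Let uu' : u <= u'. Proof. by rewrite lerDl step_length_ge0. Qed.

Lemma kac_vector_le v c s k : u <= v -> v <= u' -> `|c| <= 1 -> `|s| <= 1 ->
  `|kac_vector v c s k| <= sech u + tanh u' ^+ n.
Proof.
move=> uv vu' c1 s1.
have v0 : 0 <= v by exact: le_trans uv.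
have t0 : 0 <= tanh u' ^+ n by rewrite exprn_ge0// tanh_ge0.
have s0 := ltW (sech_gt0 u).
have tn : `|tanh v ^+ n| <= tanh u' ^+ n.
  by rewrite normrX ger0_norm ?tanh_ge0// lerXn2r ?nnegrE ?tanh_ge0// tanh_le.
rewrite /kac_vector; case: ifP => _; last first.
  have bound r : `|r| <= 1 -> `|tanh v ^+ n * r| <= sech u + tanh u' ^+ n.
    by move=> r1; apply: le_trans (ler_normM tn r1) _; rewrite mulr1 lerDr.
  by case: ifP => _; exact: bound.
apply: (@le_trans _ _ (sech u * 1)); last by rewrite mulr1 lerDl.
apply: ler_normM; first by rewrite (ger0_norm (ltW (sech_gt0 v))) sech_le.
by rewrite normrX exprn_ile1// tanh_norm_le1.
Qed.

Let inj (k : 'I_n) : 'I_n.+2 := widen_ord (leqW (leqnSn n)) k.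

Lemma lin_kac_vector v c s w : 0 <= v ->
  `|lin a (fun k => kac_vector v c s k) w -
    sech v * (\sum_(k < n) a (inj k) (w (inj k)) * tanh v ^+ k)|
   <= 2 * tanh v ^+ n * (`|c| + `|s|).
Proof.
move=> v0; pose f k := a (inord k) (w (inord k)).
have fE (k : 'I_n.+2) : a k (w k) = f k by rewrite /f inord_val.
have -> : lin a (fun k => kac_vector v c s k) w = \sum_(k < n.+2) kac_vector v c s k * f k.
  by apply: eq_bigr => k _; rewrite fE.
have -> : \sum_(k < n) a (inj k) (w (inj k)) * tanh v ^+ k = \sum_(k < n) f k * tanh v ^+ k.
  by apply: eq_bigr => k _; rewrite (fE (inj k)).
rewrite sum_kac_vector.
rewrite (_ : _ + _ - _ = tanh v ^+ n * c * f n + tanh v ^+ n * s * f n.+1); last by ring.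
have t0 : `|tanh v ^+ n| <= tanh v ^+ n by rewrite ger0_norm// exprn_ge0// tanh_ge0.
apply: le_trans (ler_normD _ _) _; rewrite mulrDr lerD//.
  rewrite [leRHS](_ : _ = tanh v ^+ n * `|c| * 2); last by ring.
  by apply: ler_normM; [exact: ler_normM|exact: a_le2].
rewrite [leRHS](_ : _ = tanh v ^+ n * `|s| * 2); last by ring.
by apply: ler_normM; [exact: ler_normM|exact: a_le2].
Qed.

(** The tolerance [2 * sech u] leaves room for the nonrandom leading coefficient, so that [Z] may be
    the actual polynomial up to a positive factor. *)
Lemma kac_step (Z Z' : {ffun 'I_n.+2 -> T} -> R) :
  (forall w, `|Z w - sech u * (\sum_(k < n) a (inj k) (w (inj k)) * tanh u ^+ k)|
     <= 2 * sech u) ->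
  (forall w, `|Z' w - sech u' * (\sum_(k < n) a (inj k) (w (inj k)) * tanh u' ^+ k)|
     <= 2 * sech u') ->
  1 / N%:R - 2 / N%:R ^+ 3 - 1608 * N%:R ^+ 10 * (sech u + tanh u' ^+ n) <=
  expect (fun w => (Z w * Z' w < 0)%R%:R).
Proof.
move=> HZ HZ'.
(* The tails point at angles 0 and [be], whose cosine is the required correlation. Then [y] is
   obtained from [x'] by Gram-Schmidt; dividing by [sin be] costs at most a factor [N]. *)
pose x (k : 'I_n.+2) := kac_vector u 1 0 k.
pose x' (k : 'I_n.+2) := kac_vector u' (cos be) (sin be) k.
pose y k := (x' k - cos be * x k) / sin be.
pose eta0 := sech u + tanh u' ^+ n.
have N1 : 1 <= N%:R :> R by rewrite ler1n (leq_trans _ N_ge5).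
have N0 : 0 < N%:R :> R by exact: lt_le_trans N1.
have sN := @sin_step_angle R N N_ge5; rewrite -/be in sN.
have s0 : 0 < sin be by apply: lt_le_trans sN; exact: divr_gt0.
have t0 : 0 <= tanh u' ^+ n by rewrite exprn_ge0// tanh_ge0.
have e0 : 0 <= eta0 by rewrite addr_ge0// ltW// sech_gt0.
have sech0 : sech 0 = 1 :> R by rewrite /sech oppr0 expR0 divff// pnatr_eq0.
have x1 : \sum_k x k ^+ 2 = 1.
  by under eq_bigr do rewrite expr2; rewrite kac_vector_dot subrr sech0//; ring.
have x'1 : \sum_k x' k ^+ 2 = 1.
  under eq_bigr do rewrite expr2; rewrite kac_vector_dot subrr sech0//.
  by rewrite -!expr2 cos2Dsin2.
have u'u : sech (u' - u) = cos be by rewrite /u' [u + _]addrC addrK sech_step_length.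
have xx' : \sum_k x k * x' k = cos be.
  by rewrite kac_vector_dot u'u; ring.
have xy : \sum_k x k * y k = 0.
  transitivity ((\sum_k (x k * x' k) - cos be * \sum_k x k ^+ 2) / sin be).
    rewrite mulr_sumr -sumrB mulr_suml; apply: eq_bigr => k _; rewrite /y; ring.
  by rewrite x1 xx' mulr1 subrr mul0r.
have y1 : \sum_k y k ^+ 2 = 1.
  transitivity ((\sum_k x' k ^+ 2 - 2 * cos be * \sum_k (x k * x' k)
    + cos be ^+ 2 * \sum_k x k ^+ 2) / sin be ^+ 2).
    rewrite !mulr_sumr -sumrB -big_split mulr_suml; apply: eq_bigr => k _; rewrite /y /=.
    by field; rewrite gt_eqF.
  rewrite x1 x'1 xx' mulr1 -mulrA -expr2.
  rewrite (_ : 1 - _ + _ = 1 - cos be ^+ 2); last by ring.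
  by rewrite -sin2cos2 divff// expf_neq0// gt_eqF.
have xeta k : `|x k| <= eta0 by apply: kac_vector_le; rewrite ?normr1 ?normr0.
have x'eta k : `|x' k| <= eta0 by apply: kac_vector_le; rewrite ?cos_max ?sin_max.
have yeta k : `|y k| <= 2 * N%:R * eta0.
  have H : `|x' k - cos be * x k| <= 2 * eta0.
    rewrite (le_trans (ler_normB _ _))//.
    have : `|cos be * x k| <= 1 * eta0 by rewrite ler_normM// cos_max.
    have := x'eta k; lra.
  rewrite [leRHS](_ : _ = 2 * eta0 * N%:R); last by ring.
  apply: ler_normM => //; rewrite normfV gtr0_norm// -[leRHS]invrK lef_pV2 ?posrE ?invr_gt0//.
  by rewrite -div1r.
have xeta' k : `|x k| <= 2 * N%:R * eta0.
  apply: le_trans (xeta k) _; rewrite ler_peMl//; lra.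
have tp : forall w, `|Z w - lin a x w| <= 4 * eta0.
  move=> w; have := HZ w; have := @lin_kac_vector u 1 0 w u_ge0.
  rewrite normr1 normr0 addr0 mulr1 distrC => h1 h2.
  apply: le_trans (ler_distD _ _ _) (le_trans (lerD h2 h1) _).
  have : tanh u ^+ n <= tanh u' ^+ n.
    by rewrite lerXn2r ?nnegrE ?tanh_ge0// tanh_le.
  by rewrite /eta0; have := sech_gt0 u; lra.
have x'E w : lin a x' w = cos be * lin a x w + sin be * lin a y w.
  rewrite -[RHS]mul1r -lin_comb; apply: eq_bigr => k _; congr (_ * _).
  by rewrite /y; field; rewrite gt_eqF.
have tp' : forall w, `|Z' w - (cos be * lin a x w + sin be * lin a y w)| <= 4 * eta0.
  move=> w; have := HZ' w; have := @lin_kac_vector u' (cos be) (sin be) w u'_ge0.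
  rewrite distrC => h1 h2; rewrite -x'E.
  apply: le_trans (ler_distD _ _ _) (le_trans (lerD h2 h1) _).
  have h3 : `|cos be| + `|sin be| <= 2 by rewrite -[2]/(1 + 1) lerD// ?cos_max ?sin_max.
  have := ler_wpM2l t0 h3.
  by rewrite /eta0; have := sech_le u_ge0 uu'; have := sech_gt0 u; lra.
have d1 : 1 <= N%:R ^+ 3 :> R by rewrite exprn_ege1.
have Npos : (0 < N)%N by rewrite (leq_trans _ N_ge5).
(* With [d = N ^+ 3] the near-zero loss is [2 / N ^+ 3]. The other two losses are [1600 * N ^+ 10]
   and [8 * N ^+ 3] times [eta0], together at most [1608 * N ^+ 10 * eta0]. *)
have := @sign_change_prob R _ T a T_gt0 a_mean a_var a_le2 x y (N%:R ^+ 3) (2 * N%:R * eta0)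
  (4 * eta0) N Z Z' x1 y1 xy xeta' yeta d1 Npos tp tp'.
apply: le_trans; rewrite -/eta0.
have H : N%:R ^+ 3 * eta0 <= N%:R ^+ 10 * eta0.
  by rewrite ler_wpM2r// ler_weXn2l.
have -> : 800 * (N%:R ^+ 3) ^+ 3 * (2 * N%:R * eta0) = 1600 * (N%:R ^+ 10 * eta0) by ring.
have -> : 2 * N%:R ^+ 3 * (4 * eta0) = 8 * (N%:R ^+ 3 * eta0) by ring.
by rewrite -[1608 * _ * _]mulrA; lra.
Qed.

End KacStep.

(** * The mesh of variable step size and its total loss *)

Section Blocks.
Context {R : realType}.

(* Block j consists of N = [block_size B j] steps of angle pi/N.  The error
   probabilities decay exponentially in the distance of j to both ends of the range,
   so N may grow linearly with that distance, which makes the sum of 1/N^2 bounded. *)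
Definition block_size (B j : nat) : nat := (minn j.+1 (B - j)).+4.

(** The mesh begins at 1 so that [tanh] is at least 1/2 on it; the reversed polynomial gets divided
    by [tanh]. *)
Definition block_start (B j : nat) : R :=
  1 + \sum_(k < j) (block_size B k)%:R * step_length (block_size B k).

Definition mesh (B j i : nat) : R := block_start B j + i%:R * step_length (block_size B j).

Lemma block_size_ge5 B j : (j < B)%N -> (5 <= block_size B j)%N.
Proof. by rewrite /block_size => jB; lia. Qed.

Lemma block_startS B j :
  block_start B j.+1 = block_start B j + (block_size B j)%:R * step_length (block_size B j).
Proof. by rewrite /block_start big_ord_recr addrA. Qed.

(** Each term is below [1 / ((k + 1) * (k + 2))], with k measured from the nearer end. One
    telescoping sum for each end contributes at most 1. *)
Lemma sum_inv_block_size B : \sum_(j < B) ((block_size B j)%:R ^+ 2)^-1 <= 2 :> R.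
Proof.
pose g k : R := k.+1%:R^-1 - k.+2%:R^-1.
have g_sum : \sum_(j < B) g j <= 1.
  rewrite -(big_mkord xpredT g).
  rewrite (telescope_sumr_eq (fun k => - k.+1%:R^-1)) => [|//|k _]; last by rewrite /g; ring.
  by rewrite invr1 opprK addrC gerBl invr_ge0.
have -> : 2 = 1 + 1 :> R by [].
apply: le_trans (lerD g_sum g_sum).
rewrite [X in _ <= _ + X](reindex_inj rev_ord_inj) -big_split /=; apply: ler_sum => j _.
have inv_sq (m k : nat) : m = k.+1 -> ((m.+4)%:R ^+ 2)^-1 <= g k.
  move=> ->; rewrite /g.
  have k0 : 0 <= k%:R :> R by [].
  have -> : k.+1%:R^-1 - k.+2%:R^-1 = (k.+1%:R * k.+2%:R)^-1 :> R.
    rewrite -natr1 -(natr1 k.+1) -natr1; field; rewrite !gt_eqF//; lra.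
  rewrite lef_pV2 ?posrE ?mulr_gt0 ?exprn_gt0 ?ltr0n//.
  by rewrite expr2 -!natrM ler_nat; lia.
have g0 k : 0 <= g k by rewrite /g subr_ge0 lef_pV2 ?posrE ?ltr0n// ler_nat.
rewrite /block_size; have jB := ltn_ord j.
have [H|H] := leqP j.+1 (B - j).
  by apply: le_trans (inv_sq _ j erefl) _; rewrite lerDl.
have E : (B - j)%N = (B - j.+1).+1 by lia.
by apply: le_trans (inv_sq _ _ E) _; rewrite lerDr.
Qed.

Lemma block_length_bounds B j (N := block_size B j) : (j < B)%N ->
  pi <= N%:R * @step_length R N <= pi + pi ^+ 3 * (N%:R ^+ 2)^-1.
Proof.
move=> jB; have N5 := block_size_ge5 jB; rewrite -/N in N5.
have N0 : 0 < N%:R :> R by rewrite ltr0n (leq_trans _ N5).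
have /andP[h1 h2] := @step_length_bounds R N N5.
apply/andP; split.
  by rewrite -ler_pdivrMl// mulrC.
apply: le_trans (ler_wpM2l (ltW N0) h2) _.
by rewrite le_eqVlt; apply/orP; left; apply/eqP; field; rewrite gt_eqF.
Qed.

Lemma block_start_ge B j : (j <= B)%N -> 1 + j%:R <= block_start B j.
Proof.
elim: j => [|j IH] jB; first by rewrite /block_start big_ord0 !addr0.
rewrite block_startS -natr1 addrA lerD ?IH ?(ltnW jB)//.
have /andP[+ _] := block_length_bounds jB.
by apply: le_trans; have := @pi_ge2 R; lra.
Qed.

Lemma block_start_le B j : (j <= B)%N ->
  block_start B j <= 1 + j%:R * pi + pi ^+ 3 * \sum_(k < j) ((block_size B k)%:R ^+ 2)^-1.
Proof.
elim: j => [|j IH] jB; first by rewrite /block_start !big_ord0 mul0r mulr0 !addr0.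
rewrite block_startS big_ord_recr /= -natr1.
have /andP[_ +] := block_length_bounds jB.
have := IH (ltnW jB); lra.
Qed.

Lemma block_start_le_linear B j : (j <= B)%N ->
  block_start B j <= 1 + 2 * pi ^+ 3 + j%:R * pi.
Proof.
move=> jB; apply: le_trans (block_start_le jB) _.
have h : \sum_(k < j) ((block_size B k)%:R ^+ 2)^-1 <= 2 :> R.
  apply: le_trans (sum_inv_block_size B).
  rewrite -!(big_mkord xpredT (fun k => ((block_size B k)%:R ^+ 2)^-1)).
  rewrite [leRHS](big_cat_nat (leq0n j) jB)//= lerDl.
  by apply: sumr_ge0 => k _; rewrite invr_ge0; exact: exprn_ge0.
have := ler_wpM2l (exprn_ge0 3 (@pi_ge0 R)) h; lra.
Qed.

(** The 13th power of [N / 13 <= expR (N / 13)]. The exponent is 10 from [kac_step] plus 3 from the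
    denominator [N ^+ 3]. *)
Lemma expR_dominates_power (N : nat) : N%:R ^+ 13 * expR (- N%:R) <= 13 ^+ 13 :> R.
Proof.
rewrite expRN ler_pdivrMr ?expR_gt0// -[N%:R in leRHS](@divfK _ 13)//.
rewrite expRM_natr -exprMn lerXn2r ?nnegrE ?mulr_ge0 ?expR_ge0//.
have := expR_ge1Dx (N%:R / 13 : R); lra.
Qed.

(** Here [4824 = 1608 * 3], because [sech] and the tail contribute [2 + 1] times
    [expR 4 * expR (- N)]. *)
Definition step_loss : R := 2 + 4824 * expR 4 * 13 ^+ 13.

(** [N - 4] is the smaller of [j + 1] and [B - j]. The mesh point is at least [j + 1], which bounds
    [sech]; twice the next one is at most [ln n - (B - j - 1)], which bounds the tail. *)
Lemma mesh_step_loss n B j i (N := block_size B j) : (0 < n)%N -> (j < B)%N -> (i < N)%N ->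
  1 + 2 * pi ^+ 3 + B%:R * pi <= ln n%:R / 2 :> R ->
  1 / N%:R - step_loss / N%:R ^+ 3 <=
  1 / N%:R - 2 / N%:R ^+ 3 -
    1608 * N%:R ^+ 10 * (sech (mesh B j i) + tanh (mesh B j i.+1) ^+ n).
Proof.
move=> n0 jB iN hn; have N5 := block_size_ge5 jB; rewrite -/N in N5.
have N0 : 0 < N%:R :> R by rewrite ltr0n (leq_trans _ N5).
have s0 : 0 <= step_length N :> R by exact: step_length_ge0.
have j1 := block_start_ge (ltnW jB).
have l1 : (minn j.+1 (B - j))%:R = N%:R - 4 :> R.
  by rewrite /N /block_size -[(minn _ _).+4]addn4 natrD addrK.
have m1 : 1 + j%:R <= mesh B j i by rewrite (le_trans j1)// lerDl mulr_ge0.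
have S1 : sech (mesh B j i) <= 2 * (expR 4 * expR (- N%:R)).
  apply: le_trans (sech_le_expR _) _; rewrite ler_wpM2l// -expRD ler_expR.
  have : (minn j.+1 (B - j))%:R <= j.+1%:R :> R by rewrite ler_nat geq_minl.
  rewrite l1 -natr1; move: m1; lra.
have m0 : 0 <= mesh B j i.+1 by rewrite addr_ge0 ?mulr_ge0// (le_trans _ j1)// addr_ge0.
have m2 : mesh B j i.+1 <= block_start B j.+1.
  by rewrite block_startS lerD2l ler_wpM2r// ler_nat.
have T1 : tanh (mesh B j i.+1) ^+ n <= expR 4 * expR (- N%:R).
  apply: le_trans (tanh_expn_le _ m0) _; rewrite -expRD ler_expR.
  have -> : n%:R = expR (ln n%:R) :> R by rewrite lnK// posrE ltr0n.
  rewrite -expRD.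
  (* The double exponential decay is weakened to a single one by [1 + x <= expR x]. *)
  apply: le_trans (_ : - (1 + (B%:R - j%:R - 1)) <= _); last first.
    have : (minn j.+1 (B - j))%:R <= (B - j)%:R :> R by rewrite ler_nat geq_minr.
    rewrite l1 natrB ?(ltnW jB)//; lra.
  rewrite lerN2; apply: le_trans (expR_ge1Dx _) _; rewrite ler_expR.
  have := le_trans m2 (block_start_le_linear jB).
  have jB' : j.+1%:R <= B%:R :> R by rewrite ler_nat.
  rewrite -natr1 in jB' *; have := @pi_ge2 R => p2.
  have : (B%:R - (j%:R + 1)) * 2 <= (B%:R - (j%:R + 1)) * pi :> R by rewrite ler_wpM2l// subr_ge0.
  move: hn; lra.
rewrite -addrA lerD2l -opprD lerN2.
rewrite ler_pdivlMr ?exprn_gt0// mulrDl divfK ?expf_neq0 ?gt_eqF//.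
rewrite lerD2l [leLHS](_ : _ = 1608 * N%:R ^+ 13 * (sech (mesh B j i) + tanh (mesh B j i.+1) ^+ n));
  last by rewrite (exprD _ 10 3); ring.
have P0 : 0 <= 1608 * N%:R ^+ 13 :> R.
  by apply: mulr_ge0; [exact: ler0n|exact/exprn_ge0/ler0n].
apply: le_trans (ler_wpM2l P0 (lerD S1 T1)) _.
rewrite [leLHS](_ : _ = 4824 * expR 4 * (N%:R ^+ 13 * expR (- N%:R))); last first.
  by set p := N%:R ^+ 13; ring.
apply: ler_wpM2l; last exact: expR_dominates_power.
by apply: mulr_ge0; [exact: ler0n|exact: expR_ge0].
Qed.

End Blocks.

Lemma step_loss_ge0 (R : realType) : 0 <= step_loss :> R.
Proof.
apply: addr_ge0; first exact: ler0n.
apply: mulr_ge0; last exact/exprn_ge0/ler0n.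
by apply: mulr_ge0; [exact: ler0n|exact: expR_ge0].
Qed.

Lemma meshS (R : realType) B j i :
  mesh B j i.+1 = mesh B j i + step_length (block_size B j) :> R.
Proof. by rewrite /mesh -natr1 mulrDl mul1r addrA. Qed.

Lemma mesh_ge1 (R : realType) B j i : (j < B)%N -> 1 <= mesh B j i :> R.
Proof.
move=> jB; have := @block_start_ge R _ _ (ltnW jB) => h.
have s0 := @step_length_ge0 R _ (block_size_ge5 jB).
have h2 : 0 <= i%:R * step_length (block_size B j) :> R by rewrite mulr_ge0.
have h3 : 0 <= j%:R :> R by [].
rewrite /mesh; lra.
Qed.

(** * Expected number of sign changes along the mesh *)

Section ExpectedSignChanges.
Context {R : realType} {T : finType}.
Variables (n : nat) (a : 'I_n.+2 -> T -> R).
Hypothesis T_gt0 : (0 < #|T|)%N.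
Hypothesis a_mean : forall i, \sum_s a i s = 0.
Hypothesis a_var : forall i, \sum_s a i s ^+ 2 = #|T|%:R.
Hypothesis a_le2 : forall i s, `|a i s| <= 2.

Let inj (k : 'I_n) : 'I_n.+2 := widen_ord (leqW (leqnSn n)) k.

(** The [N] steps of a block add up to [1 - step_loss / N ^+ 2], and the sum of [1 / N ^+ 2] over
    the blocks is at most 2. *)
Lemma expected_sign_changes (B : nat) (Z : R -> {ffun 'I_n.+2 -> T} -> R) : (0 < n)%N ->
  1 + 2 * pi ^+ 3 + B%:R * pi <= ln n%:R / 2 :> R ->
  (forall u w, 1 <= u ->
     `|Z u w - sech u * (\sum_(k < n) a (inj k) (w (inj k)) * tanh u ^+ k)| <= 2 * sech u) ->
  B%:R - 2 * @step_loss R <= expect (fun w => \sum_(j < B) \sum_(i < block_size B j)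
    (Z (mesh B j i) w * Z (mesh B j i.+1) w < 0)%R%:R).
Proof.
move=> n0 hn HZ; rewrite expect_sum.
have -> : B%:R - 2 * step_loss = \sum_(j < B) 1 - 2 * step_loss :> R.
  by rewrite sumr_const card_ord.
have h := ler_wpM2l (step_loss_ge0 R) (@sum_inv_block_size R B).
apply: le_trans (_ : \sum_(j < B) (1 - step_loss * ((block_size B j)%:R ^+ 2)^-1) <= _).
  by rewrite sumrB -mulr_sumr lerD2l lerN2 (mulrC 2).
apply: ler_sum => j _; rewrite expect_sum.
have jB := ltn_ord j; have N5 := block_size_ge5 jB.
set N := block_size B j.
have N0 : N%:R != 0 :> R by rewrite pnatr_eq0 -lt0n (leq_trans _ N5).
have -> : 1 - step_loss * (N%:R ^+ 2)^-1 = \sum_(i < N) (1 / N%:R - step_loss / N%:R ^+ 3) :> R.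
  by rewrite sumr_const card_ord -mulr_natl; field.
apply: ler_sum => i _.
apply: le_trans (mesh_step_loss n0 jB (ltn_ord i) hn) _.
rewrite meshS; have m1 := @mesh_ge1 R B j i jB.
have s0 := @step_length_ge0 R _ N5.
apply: kac_step => //; first exact: le_trans m1.
- by move=> w; exact: HZ.
- by move=> w; apply: HZ; rewrite -meshS mesh_ge1.
Qed.

End ExpectedSignChanges.

Lemma expect_reindex (R : realType) (I T : finType) (f : I -> I) (F : {ffun I -> T} -> R) :
  involutive f -> expect (fun w => F [ffun i => w (f i)]) = expect F.
Proof.
move=> fK; rewrite /expect; congr (_ / _).
rewrite [RHS](reindex_inj (h := fun w : {ffun I -> T} => [ffun i => w (f i)])) //.
by apply: inv_inj => w; apply/ffunP => i; rewrite !ffunE fK.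
Qed.

(** * From sign changes to distinct real roots *)

Section RealRoots.
Context {R : realType}.
Implicit Types (D : {poly R}) (rs : seq R).

(** Strict inequalities keep the root lists of adjacent intervals disjoint. *)
Definition roots_in D (b c : R) rs := uniq rs && all (fun r => [&& b < r, r < c & root D r]) rs.

Lemma roots_in_cat D b c d rs rs' : b <= c -> c <= d ->
  roots_in D b c rs -> roots_in D c d rs' -> roots_in D b d (rs ++ rs').
Proof.
move=> bc cd /andP[u1 /allP h1] /andP[u2 /allP h2]; apply/andP; split.
  rewrite cat_uniq u1 u2 andbT /=; apply/hasPn => r /h2 /and3P[cr _ _].
  by apply/negP => /h1 /and3P[_ rc _]; have := lt_trans cr rc; rewrite ltxx.
rewrite all_cat; apply/andP; split; apply/allP => r.
  by move=> /h1 /and3P[-> rc ->]; rewrite (lt_le_trans rc).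
by move=> /h2 /and3P[cr -> ->]; rewrite (le_lt_trans bc).
Qed.

Lemma roots_of_sign_changes D (s : nat -> R) m : (forall i, (i < m)%N -> s i < s i.+1) ->
  s 0%N <= s m /\ exists2 rs, roots_in D (s 0%N) (s m) rs &
    size rs = (\sum_(i < m) (D.[s i] * D.[s i.+1] < 0)%R)%N.
Proof.
elim: m => [|m IH] sm; first by split => //; exists [::]; rewrite // big_ord0.
have [i im|s0m [rs Hrs szrs]] := IH; first by apply: sm; exact: ltnW.
have smm := sm m (ltnSn m).
split; first exact: le_trans (ltW smm).
suff [rs' Hrs' szrs'] : exists2 rs', roots_in D (s m) (s m.+1) rs' &
    size rs' = (D.[s m] * D.[s m.+1] < 0)%R.
  exists (rs ++ rs'); first exact: roots_in_cat (ltW smm) Hrs Hrs'.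
  by rewrite size_cat big_ord_recr /= szrs szrs'.
have [neg|_] := boolP (D.[s m] * D.[s m.+1] < 0); last by exists [::].
have [r] := poly_ivtoo (ltW smm) neg.
rewrite in_itv/= => /andP[r1 r2] rr; exists [:: r] => //.
by rewrite /roots_in /= r1 r2 rr.
Qed.

Lemma mesh_roots D B : exists2 rs, roots_in D 0 1 rs &
  size rs = (\sum_(j < B) \sum_(i < block_size B j)
    (D.[tanh (mesh B j i)] * D.[tanh (mesh B j i.+1)] < 0)%R)%N.
Proof.
suff H m : (m <= B)%N -> tanh (block_start B 0) <= tanh (@block_start R B m) /\
   exists2 rs, roots_in D (tanh (block_start B 0)) (tanh (block_start B m)) rs &
   size rs = (\sum_(j < m) \sum_(i < block_size B j)
    (D.[tanh (mesh B j i)] * D.[tanh (mesh B j i.+1)] < 0)%R)%N.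
  have [_ [rs /andP[u1 /allP h1] sz]] := H B (leqnn B); exists rs => //.
  apply/andP; split=> //; apply/allP => r /h1 /and3P[r1 r2 ->]; rewrite andbT.
  rewrite (lt_trans r2 (tanh_lt1 _)) andbT (le_lt_trans _ r1)// tanh_ge0//.
  by rewrite /block_start big_ord0 addr0.
elim: m => [|m IH] mB; first by split => //; exists [::]; rewrite // big_ord0.
have [le0 [rs Hrs sz]] := IH (ltnW mB).
have N5 := block_size_ge5 mB.
have [|le1 [rs' Hrs' sz']] := @roots_of_sign_changes D (fun i => tanh (mesh B m i)) (block_size B m).
  move=> i _; apply: tanh_lt; rewrite meshS ltrDl.
  have /andP[+ _] := @step_length_bounds R _ N5.
  by apply: lt_le_trans; exact: step_angle_gt0.
have E0 : mesh B m 0 = block_start B m :> R by rewrite /mesh mul0r addr0.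
have E1 : mesh B m (block_size B m) = block_start B m.+1 :> R by rewrite block_startS.
rewrite E0 E1 in le1 Hrs'.
split; first exact: le_trans le1.
exists (rs ++ rs'); first exact: roots_in_cat Hrs Hrs'.
by rewrite size_cat big_ord_recr /= sz sz'.
Qed.

End RealRoots.

(** * Roots beyond 1 via the reciprocal polynomial *)

Section TwoSided.
Context {R : realType}.
Variables (n : nat) (f : nat -> R) (s : R).

Definition ray_poly : {poly R} := \poly_(k < n) f k + s *: 'X^n.

(** For [t != 0] its value is [t ^+ n] times that of [ray_poly] at [t^-1]. *)
Definition ray_poly_rev : {poly R} := 'X * \poly_(k < n) f (n.-1 - k)%N + s%:P.

Lemma horner_ray_poly t : ray_poly.[t] = \sum_(k < n) f k * t ^+ k + s * t ^+ n.
Proof. by rewrite hornerD horner_poly hornerZ hornerXn. Qed.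

Lemma horner_ray_poly_rev t :
  ray_poly_rev.[t] = t * (\sum_(k < n) f (n.-1 - k)%N * t ^+ k) + s.
Proof. by rewrite hornerD hornerM hornerX horner_poly hornerC. Qed.

Lemma root_ray_poly_rev t : t != 0 -> root ray_poly_rev t -> root ray_poly t^-1.
Proof.
move=> t0 /rootP; rewrite horner_ray_poly_rev => H; apply/rootP.
suff E : \sum_(k < n) f k * t^-1 ^+ k =
    t^-1 ^+ n * (t * \sum_(k < n) f (n.-1 - k)%N * t ^+ k).
  by rewrite horner_ray_poly E [s * _]mulrC -mulrDr H mulr0.
rewrite mulrA mulr_sumr (reindex_inj rev_ord_inj) /=.
apply: eq_bigr => k _; have kn := ltn_ord k.
have -> : (n - k.+1 = n.-1 - k)%N by lia.
have -> : t^-1 ^+ n = t^-1 ^+ (n.-1 - k) * t^-1 ^+ k * t^-1.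
  by rewrite -exprD -exprSr; congr (_ ^+ _); lia.
have : t^-1 ^+ k * t ^+ k = 1 by rewrite -exprMn mulVf// expr1n.
have : t^-1 * t = 1 by exact: mulVf.
set p := t^-1 ^+ (_ - _); set q := t^-1 ^+ k; set q' := t ^+ k; set r := t^-1 => rt qq.
rewrite (_ : p * q * r * t * _ = f (n.-1 - k)%N * p * (r * t) * (q * q')); last by ring.
by rewrite rt qq !mulr1.
Qed.

(** Both polynomials have their roots counted in the open interval from 0 to 1. Inverting those of
    the reversed one puts them above 1, away from the first list. *)
Lemma ray_roots B : exists ts : seq R,
  [/\ uniq ts, all (fun t => (0 < t) && root ray_poly t) ts &
  size ts = (\sum_(j < B) \sum_(i < block_size B j)
     (ray_poly.[tanh (mesh B j i)] * ray_poly.[tanh (mesh B j i.+1)] < 0)%R +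
   \sum_(j < B) \sum_(i < block_size B j)
     (ray_poly_rev.[tanh (mesh B j i)] * ray_poly_rev.[tanh (mesh B j i.+1)] < 0)%R)%N].
Proof.
have [rs /andP[u1 /allP h1] <-] := mesh_roots ray_poly B.
have [rs' /andP[u2 /allP h2] <-] := mesh_roots ray_poly_rev B.
exists (rs ++ [seq t^-1 | t <- rs']); split; last by rewrite size_cat size_map.
  rewrite cat_uniq u1 map_inj_uniq ?u2 ?andbT /=; last exact: invr_inj.
  apply/hasPn => _ /mapP[r /h2 /and3P[r0 r1 _] ->].
  by apply/negP => /h1 /and3P[_ + _]; rewrite invf_lt1// ltNge (ltW r1).
rewrite all_cat; apply/andP; split; apply/allP => r.
  by move=> /h1 /and3P[-> _ ->].
move=> /mapP[t /h2 /and3P[t0 _ rt] ->]; rewrite invr_gt0 t0/=.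
by apply: root_ray_poly_rev rt; rewrite gt_eqF.
Qed.

End TwoSided.

(** * Rays through the roots of -1 and the random coefficients on them *)

Section Rays.
Context {R : realType}.
Local Notation Re := complex.Re.
Local Notation Im := complex.Im.
Implicit Types (r z : R[i]).

Lemma norm1_Re_Im r : `|r| = 1 -> Re r ^+ 2 + Im r ^+ 2 = 1.
Proof.
move=> r1; have := add_Re2_Im2 r; rewrite r1 expr1n => h.
exact: (@complexI R).
Qed.

(** The roots of [X^(2n) + 1] are simple because it divides the separable polynomial
    [X^(4n) - 1]. *)
Lemma exists_rays n : (0 < n)%N -> exists rays : seq R[i],
  [/\ uniq rays, size rays = (2 * n)%N & {in rays, forall r, r ^+ (2 * n) = -1}].
Proof.
move=> n0; have [rays E] := closed_field_poly_normal ('X^(2 * n) + 1 : {poly R[i]}).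
have n20 : (0 < 2 * n)%N by rewrite muln_gt0.
have E1 : 'X^(2 * n) + 1 = \prod_(z <- rays) ('X - z%:P) :> {poly R[i]}.
  by rewrite E lead_coefDl ?size_polyXn ?size_poly1 ?ltnS// lead_coefXn scale1r.
exists rays; split.
- rewrite -separable_prod_XsubC -E1.
  have : separable_poly ('X^(4 * n) - 1 : {poly R[i]}).
    by apply: separable_Xn_sub_1; rewrite pnatr_eq0 -lt0n muln_gt0.
  rewrite (_ : 'X^(4 * n) - 1 = ('X^(2 * n) - 1) * ('X^(2 * n) + 1)).
    by rewrite separable_mul => /and3P[].
  by rewrite -subr_sqr expr1n -exprM; congr ('X^_ - 1); lia.
- have := congr1 (fun p : {poly R[i]} => size p) E1.
  by rewrite size_prod_XsubC size_polyDl size_polyXn ?size_poly1 ?ltnS// => -[].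
- move=> r; rewrite -root_prod_XsubC -E1 => /rootP.
  by rewrite hornerD hornerXn hornerC => /eqP; rewrite addr_eq0 => /eqP.
Qed.

Variables (n : nat) (n_gt0 : (0 < n)%N) (r : R[i]).
Hypothesis rn : r ^+ (2 * n) = -1.

Lemma ray_norm : `|r| = 1.
Proof.
have n20 : (0 < 2 * n)%N by rewrite muln_gt0.
by apply/eqP; rewrite -(pexpr_eq1 n20)// -normrX rn normrN1.
Qed.

Lemma ray_expn : Re (r ^+ n) = 0.
Proof.
have : (r ^+ n - 'i%C) * (r ^+ n + 'i%C) = 0.
  by rewrite -subr_sqr -exprM mulnC rn sqr_i opprK addNr.
by move/eqP; rewrite mulf_eq0 subr_eq0 addr_eq0 => /orP[]/eqP-> /=; rewrite ?oppr0.
Qed.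

Lemma ray_Im_le1 m : `|Im (r ^+ m)| <= 1.
Proof.
have : `|r ^+ m| = 1 by rewrite normrX ray_norm expr1n.
move=> /norm1_Re_Im h; rewrite -(@ler_pXn2r _ 2)// ?nnegrE// expr1n real_normK ?num_real//.
by rewrite -h lerDr sqr_ge0.
Qed.

Definition ray_coef (k : nat) (s : 'I_4) : R := Num.sqrt 2 * Im ('i%C ^+ s * r ^+ k).

Lemma sum_ray_coef k : \sum_s ray_coef k s = 0.
Proof.
rewrite /ray_coef !big_ord_recr big_ord0 /=; case: (r ^+ k) => x y.
rewrite !exprS expr0 /=; ring.
Qed.

(** Up to sign, the four imaginary parts are [Re (r ^+ k)] and [Im (r ^+ k)], each taken twice. The
    variance therefore does not depend on the direction of [r ^+ k]. *)
Lemma sum_ray_coef2 k : \sum_s ray_coef k s ^+ 2 = 4.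
Proof.
have : `|r ^+ k| = 1 by rewrite normrX ray_norm expr1n.
move=> /norm1_Re_Im; have := sqr_sqrtr (ler0n R 2).
rewrite /ray_coef !big_ord_recr big_ord0 /=; case: (r ^+ k) => x y /=.
set q := Num.sqrt 2 => q2 xy; rewrite !exprS expr0 /=.
transitivity (2 * (q ^+ 2 * (x ^+ 2 + y ^+ 2))); first by ring.
by rewrite q2 xy; ring.
Qed.

Lemma ray_coef_le2 k s : `|ray_coef k s| <= 2.
Proof.
rewrite -(@ler_pXn2r _ 2)// ?nnegrE// real_normK ?num_real//.
rewrite (_ : 2 ^+ 2 = 4); last by ring.
rewrite -(sum_ray_coef2 k) (bigD1 s)//= lerDl.
by apply: sumr_ge0 => i _; exact: sqr_ge0.
Qed.

Let card4 : (0 < #|'I_4|)%N. Proof. by rewrite card_ord. Qed.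

Definition low_coef (w : {ffun 'I_n.+2 -> 'I_4}) (k : nat) : R := ray_coef k (w (inord k)).
(* [ray_coef] has variance 1, hence the factor sqrt 2; the polynomial z^n + 2i Im Q(z)
   on the ray is then i * sqrt 2 times [ray_poly], whose leading coefficient is not random. *)
Definition top_coef : R := Im (r ^+ n) / Num.sqrt 2.

Let top_le1 : `|top_coef| <= 1.
Proof.
have q0 : 0 < Num.sqrt 2 :> R by rewrite sqrtr_gt0.
rewrite normrM normfV (gtr0_norm q0) ler_pdivrMr// mul1r.
apply: le_trans (ray_Im_le1 n) _.
by rewrite -[leLHS]sqrtr1 ler_wsqrtr// ler1n.
Qed.

Definition changes (D : {poly R}) (B : nat) : nat :=
  (\sum_(j < B) \sum_(i < block_size B j)
     (D.[tanh (mesh B j i)] * D.[tanh (mesh B j i.+1)] < 0)%R)%N.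

Let changesE D B : (changes D B)%:R = \sum_(j < B) \sum_(i < block_size B j)
     (D.[tanh (mesh B j i)] * D.[tanh (mesh B j i.+1)] < 0)%R%:R :> R.
Proof. by rewrite /changes natr_sum; apply: eq_bigr => j _; rewrite natr_sum. Qed.

Let mul_lt0_scale (p q x y : R) : 0 < p -> 0 < q -> (p * x * (q * y) < 0) = (x * y < 0).
Proof. by move=> p0 q0; rewrite mulrACA pmulr_rlt0// mulr_gt0. Qed.

Definition unit_poly (w : {ffun 'I_n.+2 -> 'I_4}) : {poly R[i]} :=
  \poly_(k < n) 'i%C ^+ w (inord k).

Lemma harmH_ray w (t : R) : root (ray_poly n (low_coef w) top_coef) t ->
  harmH ('X^n + unit_poly w) (- unit_poly w) (t%:C%C * r) = 0.
Proof.
move=> /rootP; rewrite horner_ray_poly => Ht.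
rewrite /harmH hornerD hornerXn hornerN rmorphN /=.
set z := t%:C%C * r; set Q := (unit_poly w).[z].
have -> : z ^+ n + Q - Q^* = z ^+ n + (Q - (Q^*)%C) by rewrite addrA.
rewrite subcJ.
have ImQ : Im Q = \sum_(k < n) t ^+ k * Im ('i%C ^+ w (inord k) * r ^+ k).
  rewrite /Q horner_poly raddf_sum /=; apply: eq_bigr => k _.
  rewrite /z exprMn -rmorphXn /= mulrCA.
  by case: (_ * r ^+ k) => x y /=; rewrite mul0r addr0.
have -> : z ^+ n = (t ^+ n * Im (r ^+ n))%:C%C * 'i%C.
  rewrite /z exprMn -rmorphXn rmorphM /= -mulrA; congr (_ * _).
  have := ray_expn; case: (r ^+ n) => x y /= ->.
  by apply/eqP; rewrite eq_complex /= !mul0r !mulr0 mulr1 subr0 addr0 !eqxx.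
rewrite -(rmorphMn _ _ 1) -rmorphM -mulrDl -rmorphD /=.
(* This real factor of [i] is [sqrt 2] times [ray_poly] at [t]. *)
suff -> : t ^+ n * Im (r ^+ n) + 2 * Im Q = 0 by rewrite rmorph0 mul0r.
have q0 : Num.sqrt 2 != 0 :> R by rewrite gt_eqF// sqrtr_gt0.
have q2 := sqr_sqrtr (ler0n R 2).
rewrite -(mulr0 (Num.sqrt 2)) -Ht mulrDr addrC; congr (_ + _); last first.
  by rewrite /top_coef; field.
rewrite ImQ !mulr_sumr; apply: eq_bigr => k _.
by rewrite /low_coef /ray_coef -{1}q2; ring.
Qed.

Section Expectation.
Variable B : nat.
Hypothesis nB : 1 + 2 * pi ^+ 3 + B%:R * pi <= ln n%:R / 2 :> R.

Lemma expected_changes_inside :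
  B%:R - 2 * @step_loss R <=
  expect (fun w => (changes (ray_poly n (low_coef w) top_coef) B)%:R).
Proof.
have := @expected_sign_changes R _ n (fun k => ray_coef k) card4 (fun k => sum_ray_coef k)
  _ (fun k => ray_coef_le2 k) B
  (fun u w => sech u * (ray_poly n (low_coef w) top_coef).[tanh u]) n_gt0 nB.
move=> /(_ _ _)/le_trans; apply.
- by move=> k; rewrite card_ord sum_ray_coef2.
- move=> u w u1; rewrite horner_ray_poly mulrDr.
  have -> : \sum_(k < n) low_coef w k * tanh u ^+ k = \sum_(k < n)
      ray_coef (widen_ord (leqW (leqnSn n)) k) (w (widen_ord (leqW (leqnSn n)) k)) * tanh u ^+ k.
    apply: eq_bigr => k _; rewrite /low_coef; congr (ray_coef _ (w _) * _).
    by apply: val_inj; rewrite /= inordK//; have := ltn_ord k; lia.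
  rewrite [X in `|X|]addrC addKr [leRHS]mulrC; apply: ler_normM.
    by rewrite ger0_norm// ltW// sech_gt0.
  have : `|top_coef * tanh u ^+ n| <= 1 * 1.
    by apply: ler_normM => //; rewrite normrX exprn_ile1// tanh_norm_le1.
  by lra.
- apply: expect_le => w; rewrite changesE.
  apply: ler_sum => j _; apply: ler_sum => i _.
  by rewrite mul_lt0_scale ?sech_gt0.
Qed.

(** Reverses the [n] polynomial coefficients and fixes the two tail coordinates; being an
    involution, it preserves averages. *)
Let rv (k : 'I_n.+2) : 'I_n.+2 := if (k < n)%N then inord (n.-1 - k) else k.

Let rvK : involutive rv.
Proof.
move=> k; rewrite /rv; have [kn|kn] := boolP (k < n)%N; last first.
  by rewrite (negPf kn).
have E : (inord (n.-1 - k) : 'I_n.+2) = (n.-1 - k)%N :> nat by rewrite inordK//; lia.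
rewrite E ifT; last by lia.
by apply: val_inj; rewrite /= inordK; lia.
Qed.

Let tanh1 (u : R) : 1 <= u -> 1 / 2 <= tanh u.
Proof.
move=> u1; have := expR_ge1Dx u.
have : expR u * expR (- u) = 1 by rewrite -expRD subrr expR0.
have := expR_gt0 (- u).
rewrite /tanh ler_pdivlMr ?addr_gt0 ?expR_gt0//.
set a := expR u; set b := expR (- u); nra.
Qed.

(** Dividing by [tanh u] removes the factor [t] in front of the random sum. The nonrandom constant
    term becomes [top_coef / tanh u], at most 2 because [u >= 1]. *)
Lemma expected_changes_outside :
  B%:R - 2 * @step_loss R <=
  expect (fun w => (changes (ray_poly_rev n (low_coef w) top_coef) B)%:R).
Proof.
pose W (w : {ffun 'I_n.+2 -> 'I_4}) := [ffun i => w (rv i)] : {ffun 'I_n.+2 -> 'I_4}.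
pose D w := ray_poly_rev n (low_coef (W w)) top_coef.
have := @expected_sign_changes R _ n (fun k => ray_coef (rv k)) card4 (fun k => sum_ray_coef (rv k))
  _ (fun k => ray_coef_le2 (rv k)) B
  (fun u w => sech u / tanh u * (D w).[tanh u]) n_gt0 nB.
move=> /(_ _ _)/le_trans; apply.
- by move=> k; rewrite card_ord sum_ray_coef2.
- move=> u w u1; rewrite horner_ray_poly_rev.
  have t0 : 0 < tanh u by apply: lt_le_trans (tanh1 u1).
  have -> : \sum_(k < n) low_coef (W w) (n.-1 - k) * tanh u ^+ k = \sum_(k < n)
      ray_coef (rv (widen_ord (leqW (leqnSn n)) k)) (w (widen_ord (leqW (leqnSn n)) k)) * tanh u ^+ k.
    apply: eq_bigr => k _; rewrite /low_coef /W ffunE.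
    have kn := ltn_ord k.
    have E : inord (n.-1 - k) = rv (widen_ord (leqW (leqnSn n)) k) by rewrite /rv /= kn.
    have E' : (n.-1 - k)%N = rv (widen_ord (leqW (leqnSn n)) k) by rewrite -E inordK//; lia.
    by rewrite {1}E' E rvK.
  set S := \sum_(k < n) _.
  rewrite (_ : _ - _ = sech u * (top_coef / tanh u)); last by field; rewrite gt_eqF.
  rewrite [leRHS]mulrC; apply: ler_normM.
    by rewrite ger0_norm// ltW// sech_gt0.
  rewrite normrM normfV (gtr0_norm t0) ler_pdivrMr//.
  by apply: le_trans top_le1 _; have := tanh1 u1; lra.
- rewrite -[leRHS](expect_reindex _ rvK) -/W.
  apply: expect_le => w; rewrite changesE.
  apply: ler_sum => j _; apply: ler_sum => i _.
  have jB := ltn_ord j.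
  have tp k : 0 < tanh (mesh B j k) :> R.
    by apply: lt_le_trans (tanh1 (mesh_ge1 _ _ jB)).
  by rewrite mul_lt0_scale ?(divr_gt0 (sech_gt0 _) (tp _))//.
Qed.

End Expectation.
End Rays.

(** * Assembling the zeros over all rays and choosing the constant *)

Lemma unimod_unit_poly (R : realType) n (w : {ffun 'I_n.+2 -> 'I_4}) : (0 < n)%N ->
  unimod_poly n ('X^n + unit_poly w : {poly R[i]}) /\
  unimod_poly n.-1 (- unit_poly w : {poly R[i]}).
Proof.
move=> n0.
have ni (s : 'I_4) : `|'i%C ^+ s : R[i]| = 1.
  by rewrite normrX normc_def /= expr0n expr1n add0r sqrtr1 expr1n.
split; split.
- by rewrite size_polyDl size_polyXn// ltnS size_poly.
- move=> k; rewrite coefD coefXn coef_poly leq_eqVlt => /predU1P[->|kn].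
    by rewrite eqxx ltnn addr0 normr1.
  by rewrite kn ltn_eqF// add0r ni.
- rewrite size_polyN prednK// size_poly_eq// -normr_gt0 ni; exact: ltr01.
- move=> k kn; rewrite coefN coef_poly normrN ifT ?ni//; lia.
Qed.

(** The modulus of [t * r] recovers [t], and cancelling [t] recovers [r]. *)
Lemma uniq_polar (R : realType) (rays : seq R[i]) (ts : R[i] -> seq R) :
  uniq rays -> (forall r, uniq (ts r)) ->
  (forall r, r \in rays -> `|r| = 1) ->
  (forall r t, r \in rays -> t \in ts r -> 0 < t) ->
  uniq [seq t%:C%C * r | r <- rays, t <- ts r].
Proof.
move=> ur ut r1 t0; apply: allpairs_uniq_dep => // -[r t] -[r' t'].
move=> /allpairsPdep[p [q [pr qt]]] [-> ->].
move=> /allpairsPdep[p' [q' [pr' qt']]] [-> ->] /= E.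
have qE : q = q'.
  apply: (@complexI R); have := congr1 Num.norm E.
  rewrite !normrM (r1 _ pr) (r1 _ pr') !mulr1.
  have nq : `|q%:C%C : R[i]| = q%:C%C by rewrite ger0_norm// ler0c ltW// (t0 p).
  have nq' : `|q'%:C%C : R[i]| = q'%:C%C by rewrite ger0_norm// ler0c ltW// (t0 p').
  by rewrite nq nq'.
move: E; rewrite -qE => /mulfI -> //.
by rewrite -(rmorph0 (real_complex R)) (inj_eq (@complexI R)) gt_eqF// (t0 p).
Qed.

(** Summing expectations over the [2 * n] rays before choosing [w] lets a single coefficient choice
    serve all rays at once. Each ray contributes [B - 2 * step_loss] twice, inside and outside the
    unit circle. *)
Lemma harmonic_zeros (R : realType) n B : (0 < n)%N ->
  1 + 2 * pi ^+ 3 + B%:R * pi <= ln n%:R / 2 :> R ->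
  exists (p q : {poly R[i]}), [/\ unimod_poly n p, unimod_poly n.-1 q &
    exists zs : seq R[i], [/\ uniq zs, forall z, z \in zs -> harmH p q z = 0 &
      4 * n%:R * (B%:R - 2 * @step_loss R) <= (size zs)%:R]].
Proof.
move=> n0 nB; have [rays [ur sz rE]] := @exists_rays R n n0.
pose D (r : R[i]) (w : {ffun 'I_n.+2 -> 'I_4}) := ray_poly n (low_coef r w) (top_coef n r).
pose D' (r : R[i]) (w : {ffun 'I_n.+2 -> 'I_4}) := ray_poly_rev n (low_coef r w) (top_coef n r).
pose total (w : {ffun 'I_n.+2 -> 'I_4}) : R :=
  \sum_(r <- rays) ((changes (D r w) B)%:R + (changes (D' r w) B)%:R).
have [|w Hw] := @exists_ge_expect R 'I_n.+2 'I_4 _ total; first by rewrite card_ord.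
exists ('X^n + unit_poly w), (- unit_poly w).
have [up uq] := @unimod_unit_poly R n w n0; split => //.
have /boolp.choice[ts Hts] r := @ray_roots R n (low_coef r w) (top_coef n r) B.
exists [seq t%:C%C * r | r <- rays, t <- ts r]; split.
- apply: uniq_polar => // [r|r rr|r t rr]; first by have [] := Hts r.
    by have := ray_norm n0 (rE r rr).
  by have [_ /allP h _] := Hts r => /h /andP[].
- move=> _ /allpairsPdep[r [t [rr tr ->]]].
  have [_ /allP h _] := Hts r; have /andP[_ rt] := h _ tr.
  by have := harmH_ray (rE r rr) rt.
apply: le_trans (le_trans Hw _); last first.
  rewrite size_allpairs_dep sumnE big_map natr_sum; apply: ler_sum => r _.
  by have [_ _ ->] := Hts r; rewrite natrD.
rewrite /total expect_sum.
have -> : 4 * n%:R * (B%:R - 2 * @step_loss R) =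
    \sum_(r <- rays) (2 * (B%:R - 2 * step_loss)) :> R.
  rewrite big_const_seq count_predT sz iter_addr_0 -[RHS]mulr_natl natrM; ring.
rewrite big_seq [leRHS]big_seq; apply: ler_sum => r rr; rewrite expectD.
have := expected_changes_inside n0 (rE r rr) nB.
have := expected_changes_outside n0 (rE r rr) nB.
rewrite -/(D r) -/(D' r); lra.
Qed.

Theorem theorem1p7 (R : realType) :
  exists C : R, 0 < C /\
    forall n : nat, (2 <= n)%N ->
      exists (p q : {poly R[i]}),
        unimod_poly n p /\ unimod_poly n.-1 q /\
        exists zs : seq R[i],
          uniq zs /\ (forall z, z \in zs -> harmH p q z = 0) /\
          2 / pi * n%:R * ln (n%:R : R) - C * n%:R <= (size zs)%:R.
Proof.
pose c : R := 1 + 2 * pi ^+ 3.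
have c0 : 0 < c by rewrite ltr_wpDr// mulr_ge0// exprn_ge0// pi_ge0.
have L0 := step_loss_ge0 R.
have p0 := @pi_gt0 R.
have cp : 0 < c / pi by rewrite divr_gt0.
(* In units of [n]: [4 * c / pi] pays for the offset [c] of the range, 4 for rounding the number of
   blocks, and [8 * step_loss] for the loss in [harmonic_zeros]. *)
exists (4 * (c / pi + 1) + 8 * step_loss); split; first by lra.
move=> n n2; have n0 : (0 < n)%N by exact: leq_trans n2.
have N0 : 0 < n%:R :> R by rewrite ltr0n.
have l0 : 0 <= ln n%:R :> R by rewrite ln_ge0// ler1n.
(* The real number of blocks that exactly exhausts the admissible range; its integer part serves as
   [B]. *)
pose x : R := (ln n%:R / 2 - c) / pi.
have goal_rew (B : R) : x <= B + 1 ->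
  2 / pi * n%:R * ln (n%:R : R) - (4 * (c / pi + 1) + 8 * step_loss) * n%:R <=
  4 * n%:R * (B - 2 * @step_loss R).
  move=> xB; have := ler_wpM2l (ltW N0) xB.
  have -> : 2 / pi * n%:R * ln (n%:R : R) = 4 * (n%:R * x) + 4 * n%:R * (c / pi).
    by rewrite /x; move: p0; generalize (@pi R) => P P0; field; rewrite gt_eqF.
  lra.
have [x0|x0] := leP 0 x.
  have B1 := truncn_itv x0; set m := Num.truncn x in B1.
  have /andP[B2 B3] := B1.
  have nB : 1 + 2 * pi ^+ 3 + m%:R * pi <= ln n%:R / 2 :> R.
    move: B2; rewrite /x ler_pdivlMr// -/c; lra.
  have [p [q [up uq [zs [uz hz sz]]]]] := harmonic_zeros n0 nB.
  exists p, q; split=> //; split=> //; exists zs; split=> //; split=> //.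
  by apply: le_trans (goal_rew m%:R _) sz; rewrite natr1 ltW.
(* For small [n] no block fits, but then the claimed bound is at most 0 and any admissible pair
   works with an empty list of zeros. *)
pose w : {ffun 'I_n.+2 -> 'I_4} := [ffun=> ord0].
have [up uq] := @unimod_unit_poly R n w n0.
exists ('X^n + unit_poly w), (- unit_poly w); split=> //; split=> //.
exists [::]; split=> //; split=> //=.
apply: le_trans (goal_rew 0 _) _; first by lra.
rewrite sub0r mulrN oppr_le0; do !apply: mulr_ge0 => //; exact: ltW.
Qed.
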